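(* Let $d\ge2$, let $K:\mathbb{T}^d\to\mathbb{R}^d$ satisfy $\|K\|_{L^1}<\infty$, $\nabla\cdot K=0$ in the sense of distributions, and $K=\nabla\cdot V$ for some matrix field $V\in L^\infty(\mathbb{T}^d)$, i.e. $K_\alpha=\sum_{\beta=1}^d\partial_\beta V_{\alpha,\beta}$ for $1\le\alpha\le d$. Let $\bar\rho_0$ be a probability density on $\mathbb{T}^d$ such that $\bar\rho_0\in\mathcal{C}^\infty_\lambda(\mathbb{T}^d)$ for some $\lambda>1$ and $\|\nabla^n\bar\rho_0\|_{L^\infty}<\infty$ for all $n\ge1$, and let $\bar\rho$ be the solution of $$\partial_t\bar\rho_t=-\nabla\cdot\big(\bar\rho_t\,(K\ast\bar\rho_t)\big)+\Delta\bar\rho_t$$ on $\mathbb{R}^+\times\mathbb{T}^d$ with initial condition $\bar\rho_0$. Then for all $n\ge1$ and $\alpha_1,\dots,\alpha_n\in\{1,\dots,d\}$ there exist $C_n^u,C_n^\infty>0$ such that for all $t\ge0$, $$\|\partial_{\alpha_1,\dots,\alpha_n}\bar\rho_t\|_{L^\infty}\le C_n^u\quad\text{and}\quad\int_0^t\|\partial_{\alpha_1,\dots,\alpha_n}\bar\rho_s\|_{L^\infty}^2\,ds\le C_n^\infty.$$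
   Context: $\mathbb{T}^d$ is the $d$-dimensional $1$-periodic torus, represented as $[-\frac12,\frac12]^d$; $f\ast g(x)=\int_{\mathbb{T}^d}f(x-y)g(y)\,dy$. For $\lambda>1$, $\mathcal{C}^\infty_\lambda(\mathcal{X})$ is the set of $f\in\mathcal{C}^\infty(\mathcal{X})$ with $\frac1\lambda\le f\le\lambda$. The equation has, in the class of bounded solutions, a unique solution $\bar\rho$ with initial condition $\bar\rho_0$, and it belongs to $\mathcal{C}^\infty_\lambda(\mathbb{R}^+\times\mathbb{T}^d)$. $\partial_{\alpha_1,\dots,\alpha_n}$ denotes the iterated partial derivative in the space variables $x_{\alpha_1},\dots,x_{\alpha_n}$. *)

(* Defs.v *)
From HB Require Import structures.
From mathcomp Require Import all_boot all_order all_algebra.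
From mathcomp Require Import all_classical all_reals all_analysis.

Set Implicit Arguments.
Unset Strict Implicit.
Unset Printing Implicit Defensive.

Import Order.TTheory GRing.Theory Num.Theory.
Import numFieldNormedType.Exports.

Local Open Scope classical_set_scope.
Local Open Scope ring_scope.

(* A function on the torus T^d is a function on 'rV[R]_d (that is, R^d) that  *)
(* is 1-periodic in every coordinate; integrals over T^d are integrals over   *)
(* the fundamental domain [-1/2, 1/2]^d.                                      *)

Definition measure_rV_display : measure_display -> measure_display.
Proof. exact. Qed.

Section measurable_rV.
Context (R : realType) (n : nat).

(* The sigma-algebra of R^n generated by the coordinates, as the library does *)
(* for n.-tuple; since R is second countable, these are the Borel sets.       *)
Let coors : 'I_n -> 'rV[R]_n -> R := fun i x => x ord0 i.

Let rV_set0 : g_sigma_preimage coors set0.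
Proof. exact: sigma_algebra0. Qed.

Let rV_setC A : g_sigma_preimage coors A -> g_sigma_preimage coors (~` A).
Proof. exact: sigma_algebraC. Qed.

Let rV_bigcup (F : (set 'rV[R]_n)^nat) :
  (forall i, g_sigma_preimage coors (F i)) ->
  g_sigma_preimage coors (\bigcup_i (F i)).
Proof. exact: sigma_algebra_bigcup. Qed.

HB.instance Definition _ :=
  @isMeasurable.Build (measure_rV_display default_measure_display) 'rV[R]_n
    (g_sigma_preimage coors) rV_set0 rV_setC rV_bigcup.

End measurable_rV.

Lemma measurable_rV_coord (R : realType) n (i : 'I_n) :
  measurable_fun [set: 'rV[R]_n] (fun x : 'rV[R]_n => x ord0 i).
Proof.
move=> _ Y mY; rewrite setTI; apply: sub_sigma_algebra => /=.
rewrite -bigcup_seq/=; exists i => /=; first by rewrite mem_index_enum.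
by exists Y => //; rewrite setTI.
Qed.

Lemma measurable_fun_rV (R : realType) d (T : measurableType d) n
    (f : T -> 'rV[R]_n) :
  (forall i, measurable_fun [set: T] (fun x => f x ord0 i)) ->
  measurable_fun [set: T] f.
Proof.
move=> mf; set coors := fun (i : 'I_n) (x : 'rV[R]_n) => x ord0 i.
have : g_sigma_preimage (fun i => coors i \o f) `<=` measurable.
  apply: smallest_sub; first exact: sigma_algebra_measurable.
  case: n => [|n] in f mf coors *; first by rewrite big_ord0.
  rewrite -bigcup_mkord_ord; apply: bigcup_sub => i Ii.
  by move=> A [B mB <-]; exact: mf.
rewrite g_sigma_preimage_comp => prefS _ A mA.
by apply: prefS; exists A.
Qed.

Section torus_measure.
Context (R : realType).

Definition rV_cons n (p : measurableTypeR R * 'rV[R]_n) : 'rV[R]_n.+1 :=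
  \row_(i < n.+1) if unlift ord0 i is Some j then p.2 ord0 j else p.1.

Lemma measurable_rV_cons n :
  measurable_fun [set: measurableTypeR R * 'rV[R]_n] (@rV_cons n).
Proof.
apply: measurable_fun_rV => i.
case: (unliftP ord0 i) => [j ->|->].
  rewrite [X in measurable_fun _ X](_ : _ =
      (fun x : 'rV[R]_n => x ord0 j) \o snd).
    exact: measurableT_comp (measurable_rV_coord j) measurable_snd.
  by apply/funext => p; rewrite /rV_cons mxE liftK.
rewrite [X in measurable_fun _ X](_ : _ = fst); first exact: measurable_fst.
by apply/funext => p; rewrite /rV_cons mxE unlift_none.
Qed.

HB.instance Definition _ n :=
  isMeasurableFun.Build _ _ _ _ (@rV_cons n) (@measurable_rV_cons n).

Lemma half_ltN : - 2^-1 < 2^-1 :> R.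
Proof. by rewrite gtrN// invr_gt0 ltr0n. Qed.

(* Lebesgue measure of T^d, i.e. the d-fold product of the Lebesgue measure   *)
(* restricted to [-1/2, 1/2] (the uniform probability there, of density 1).   *)
Fixpoint torus d : probability 'rV[R]_d R :=
  match d with
  | 0 => \d_(0 : 'rV[R]_0)
  | d'.+1 => distribution
      (uniform_prob half_ltN \x torus d')%E (@rV_cons d')
  end.

End torus_measure.

Section smooth.
Context (R : realType) (V : normedModType R).

(* For V finite dimensional: f is the restriction to A of a C^oo function     *)
(* defined on an open neighbourhood of A, C^oo meaning that all iterated      *)
(* directional derivatives are differentiable. In particular smoothness on    *)
(* R^+ x T^d is up to t = 0. The class C^oo_lambda is smooth_between lambda.  *)
Definition smooth_on (A : set V) (f : V -> R) : Prop :=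
  exists (U : set V) (g : V -> R),
    [/\ open U, A `<=` U, forall x, A x -> g x = f x &
        forall (vs : seq V) x, U x ->
          differentiable (foldr (fun v h => 'D_v h) g vs) x].

Definition smooth_between (lambda : R) (A : set V) (f : V -> R) : Prop :=
  smooth_on A f /\ forall x, A x -> lambda^-1 <= f x <= lambda.

End smooth.

Section torus_calculus.
Context (R : realType) (d : nat).
Implicit Types (f g rho phi : 'rV[R]_d -> R) (F K : 'rV[R]_d -> 'rV[R]_d).

Definition torus_periodic (W : zmodType) (f : 'rV[R]_d -> W) : Prop :=
  forall i : 'I_d, periodic f (delta_mx ord0 i).

Definition partial (i : 'I_d) f : 'rV[R]_d -> R := 'D_(delta_mx ord0 i) f.

Definition partials (a : seq 'I_d) f : 'rV[R]_d -> R := foldr partial f a.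

Definition divergence F (x : 'rV[R]_d) : R :=
  \sum_(i < d) partial i (fun y => F y ord0 i) x.

Definition laplacian f (x : 'rV[R]_d) : R :=
  \sum_(i < d) partial i (partial i f) x.

Definition torus_conv K rho (x : 'rV[R]_d) : 'rV[R]_d :=
  \row_(i < d) \int[torus R d]_y (K (x - y) ord0 i * rho y).

Definition Loo_norm f : \bar R := 'N[torus R d]_+oo[EFin \o f]%E.

Definition L1_field K : Prop :=
  forall i, (torus R d).-integrable setT (fun x => (K x ord0 i)%:E).

Definition Loo_field (V : 'rV[R]_d -> 'M[R]_d) : Prop :=
  forall i j, measurable_fun setT (fun x => V x i j) /\
              (Loo_norm (fun x => V x i j) < +oo)%E.

Definition test_function phi : Prop := torus_periodic phi /\ smooth_on setT phi.

(* div K = 0 in the sense of distributions. *)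
Definition weak_div_free K : Prop :=
  forall phi, test_function phi ->
    \sum_(i < d) \int[torus R d]_x (K x ord0 i * partial i phi x) = 0.

(* K_i = sum_j d_j V_ij in the sense of distributions. *)
Definition weak_div_eq K (V : 'rV[R]_d -> 'M[R]_d) : Prop :=
  forall i phi, test_function phi ->
    \int[torus R d]_x (K x ord0 i * phi x) =
    - \sum_(j < d) \int[torus R d]_x (V x i j * partial j phi x).

Definition probability_density rho : Prop :=
  [/\ measurable_fun setT rho, forall x, 0 <= rho x &
      (\int[torus R d]_x (rho x)%:E = 1)%E].

(* rho, of which only the values at t >= 0 matter, is the solution in         *)
(* C^oo_lambda(R^+ x T^d). The equation is required for t > 0, where the time *)
(* derivative is two-sided; at t = 0 it then holds by continuity.             *)
Definition is_solution (lambda : R) K rho0 (rho : R -> 'rV[R]_d -> R) : Prop :=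
  [/\ forall t, 0 <= t -> torus_periodic (rho t),
      smooth_between lambda [set p : R * 'rV[R]_d | 0 <= p.1]
        (fun p => rho p.1 p.2),
      forall t x, 0 < t ->
        derive1 (rho^~ x) t =
        - divergence (fun y => rho t y *: torus_conv K (rho t) y) x
        + laplacian (rho t) x &
      forall x, rho 0 x = rho0 x].

End torus_calculus.

(* Main.v *)
(** The argument is an energy method. Write [u = K * rho], which is divergence
    free, so that the equation reads [d_t rho = Delta rho - u . grad rho], and let
    [E_k] be the sum of the squared [L^2] norms of the partial derivatives of
    order [k]. First, [E_0' = - 2 E_1]. Next, moving one derivative onto the test
    factor and expanding [d^a (u . grad rho)] by the Leibniz rule gives, once
    [E_1, ..., E_m] are bounded, the inequality
    [E_(m+1)' <= - E_(m+2) + C (E_1 + ... + E_(m+1))]: the factor [u] itself is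
    bounded by [|K|_1 sup rho], and a differentiated factor [K * d^c rho] is
    [V * grad d^c rho], bounded by [|V|_oo] times the square root of [E_(|c|+1)].
    Hence for each [m] a combination [G] of [E_0, ..., E_m] with nonnegative
    coefficients satisfies [E_0 + ... + E_m <= G] and
    [G' <= - (E_1 + ... + E_(m+1))]; it bounds these energies uniformly in time
    and their time integrals by [G 0]. A Sobolev inequality,
    [sup |f|^2 <= 2^d \sum_S |d_S f|_2^2] over sets [S] of coordinates, transfers
    both bounds to the sup norms. *)

Require Import Defs.
From HB Require Import structures.
From mathcomp Require Import all_boot all_order all_algebra.
From mathcomp Require Import all_classical all_reals all_analysis.
From mathcomp Require Import measurable_realfun ess_sup_inf lebesgue_integral_under ring lra.
Import Order.TTheory GRing.Theory Num.Theory.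
Import numFieldNormedType.Exports.
Local Open Scope classical_set_scope.
Local Open Scope ring_scope.
Set Implicit Arguments.
Unset Strict Implicit.
Unset Printing Implicit Defensive.

(** * Measurability and invariance of the torus measure *)

(** The obstacle is uniformity over infinite time: an error term must be linear in energies that are
    themselves dissipated, with no additive constant. Since [rho >= 1/lambda] keeps [E_0] away from
    0, [E_0] is not integrable in time and may not occur in an error term; this is why the sums on
    the right start at order 1. A Leibniz term distributes m derivatives as |c| + |b| = m over
    [K * d^c rho] and [grad d^b rho]. Through V, the first factor costs one extra derivative, so the
    term is of size [E_(|c|+1) E_(|b|+1)]. If c is nonempty, then |b|+1 <= m, the second energy is
    already known to be bounded, and the product stays linear in [E_(|c|+1)] with |c|+1 <= m+1. If c
    is empty, the second energy is [E_(m+1)], not yet bounded, and V would give a quadratic term;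
    there the integrability of K and the bound [rho <= lambda] are used instead. Only m derivatives
    fall on the nonlinear term, and not m+1, because one is integrated by parts; this spends half of
    the dissipation [2 E_(m+2)]. *)

Lemma open_measurable_rV (R : realType) n (A : set 'rV[R]_n) :
  open A -> measurable A.
Proof.
move=> oA.
(* Measurable sets are generated by the coordinates, so an open set has to be exhausted by countably
   many boxes: those with rational centre and radius 1/(k+1) that it contains. *)
pose B (p : 'rV[rat]_n * nat) : set 'rV[R]_n := \bigcap_(i in [set: 'I_n])
    (fun x : 'rV[R]_n => x ord0 i) @^-1` ball (ratr (p.1 ord0 i) : R) p.2.+1%:R^-1.
rewrite (_ : A = \bigcup_p (if `[< B p `<=` A >] then B p else set0)).
  apply: countable_bigcupT_measurable => [|p]; first exact: countableP.
  case: ifP => // _; rewrite -[B p]setCK setC_bigcap; apply: measurableC.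
  apply: countable_bigcupT_measurable => [|i]; first exact: countableP.
  apply: measurableC; rewrite -[X in measurable X]setTI.
  by apply: measurable_rV_coord => //; rewrite ball_itv; exact: measurable_itv.
apply/seteqP; split => [x Ax|x [p _]]; last by case: asboolP => // BA /BA.
have /nbhs_ballP[e /= e0 eA] := open_nbhs_nbhs (conj oA Ax).
(* A box of radius 1/(k+1) that contains x has all its points within 2/(k+1) of x, hence inside the
   ball of radius e. *)
have [k ke] : exists k, 2 * k.+1%:R^-1 < e.
  have e20 : 0 < e / 2 by rewrite divr_gt0.
  have [k _ /(_ k (leqnn _))] := near_infty_natSinv_lt (PosNum e20).
  by move=> /= ke; exists k; rewrite mulrC -ltr_pdivlMr.
have k0 : 0 < k.+1%:R^-1 :> R by rewrite invr_gt0.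
set dl := k.+1%:R^-1 in ke k0 *.
have qx i : exists q : rat, `|ratr q - x ord0 i| < dl.
  have /rat_in_itvoo[q] : x ord0 i - dl < x ord0 i + dl by lra.
  by rewrite in_itv/= => /andP[? ?]; exists q; rewrite ltr_norml; apply/andP; split; lra.
move/choice : qx => [q qx].
have Bx y : B (\row_i q i, k) y <-> forall i, `|ratr (q i) - y ord0 i| < dl.
  by split => + i; move/(_ i); rewrite /= /ball/= mxE//; apply.
exists (\row_i q i, k) => //=.
case: asboolP => [_|[]]; first exact/Bx.
move=> y /Bx qy; apply: eA; split=> // i j; rewrite ord1 /ball/=.
have := qx j; have := qy j; rewrite !ltr_norml => /andP[? ?] /andP[? ?].
by apply/andP; split; lra.
Qed.

Lemma continuous_measurable_rV (R : realType) n (f : 'rV[R]_n -> R) :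
  continuous f -> measurable_fun setT f.
Proof.
move=> cf; apply: (measurability _ (@RGenOpens.measurableE R)).
move=> _ [_ [a [b ->] <-]]; rewrite setTI.
apply: open_measurable_rV; move/continuousP : cf; apply.
exact: interval_open.
Qed.

(** * Reflections, translations and periods on the line *)

Section torus_invariance.
Context (R : realType).
Local Open Scope ereal_scope.
Notation mu := (@lebesgue_measure R).

(** By uniqueness of Lebesgue measure it is enough to test intervals []a, b]], whose preimages [[c -
    b, c - a[] have the same length. *)
Lemma lebesgue_measure_reflect (c : R) (A : set R) : measurable A ->
  mu [set x | A (c - x)%R] = mu A.
Proof.
pose phi : measurableTypeR R -> measurableTypeR R := fun x => (c - x)%R.
have mr : measurable_fun setT phi by exact: measurable_funB.
move=> mA; apply/esym; rewrite -[RHS]/(pushforward mu phi A).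
apply: (@lebesgue_measure_unique R (pushforward mu phi)) => //.
move=> _ [[a b] _ <-] /=; rewrite /pushforward /phi.
rewrite (_ : _ @^-1` _ = `[(c - b)%R, (c - a)%R[%classic); last first.
  by apply/seteqP; split => x /=; rewrite !in_itv/= => /andP[? ?]; apply/andP; split; lra.
rewrite !lebesgue_measure_itv/= !lte_fin ltrD2l ltrN2.
by case: ifP => // _; rewrite -!EFinD; congr EFin; lra.
Qed.

Lemma ge0_integral_reflect (c a b : R) (f : measurableTypeR R -> \bar R) :
  measurable_fun [set: measurableTypeR R] f -> (forall x, 0 <= f x) ->
  \int[mu]_(x in `[a, b]) f (c - x)%R = \int[mu]_(x in `[(c - b)%R, (c - a)%R]) f x.
Proof.
move=> mf f0.
pose phi : measurableTypeR R -> measurableTypeR R := fun x => (c - x)%R.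
have mr : measurable_fun setT phi by exact: measurable_funB.
have -> : \int[mu]_(x in `[(c - b)%R, (c - a)%R]) f x =
    \int[pushforward mu phi]_(x in `[(c - b)%R, (c - a)%R]) f x.
  apply: eq_measure_integral => // A mA _.
  by rewrite /pushforward/= -(lebesgue_measure_reflect c).
rewrite ge0_integral_pushforward//; last by apply: measurable_funTS.
congr integral.
by apply/seteqP; split => x /=; rewrite /phi !in_itv/= => /andP[? ?]; apply/andP; split; lra.
Qed.


(** A translation is the composition of two reflections, x to -x and x to c - x. *)
Lemma ge0_integral_shift (c a b : R) (f : measurableTypeR R -> \bar R) :
  measurable_fun [set: measurableTypeR R] f -> (forall x, 0 <= f x) ->
  \int[mu]_(x in `[a, b]) f (x + c)%R = \int[mu]_(x in `[(a + c)%R, (b + c)%R]) f x.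
Proof.
move=> mf f0; have := @ge0_integral_reflect 0%R (- b)%R (- a)%R (fun x => f (x + c)%R).
have -> : (0 - - a = a)%R by lra. have -> : (0 - - b = b)%R by lra.
move=> <- //; last first.
  by apply: measurableT_comp => //; exact: measurable_funD.
rewrite (eq_integral (fun x : measurableTypeR R => f (c - x)%R)); last first.
  by move=> x _; congr (f _); lra.
by rewrite ge0_integral_reflect// !opprK !(addrC c).
Qed.

(** Integer translations reduce c to its fractional part r. Then [[r, r + 1[] is cut at 1, and the
    piece beyond 1 is moved back by one period. Half-open intervals make the cutting exact. *)
Lemma ge0_integral_shift_periodic (c : R) (f : measurableTypeR R -> \bar R) :
  measurable_fun [set: measurableTypeR R] f -> (forall x, 0 <= f x) ->
  (forall x, f (x + 1)%R = f x) ->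
  \int[mu]_(x in `[c, (c + 1)%R]) f x = \int[mu]_(x in `[0%R, 1%R]) f x.
Proof.
move=> mf f0 f1.
have mfS (A : set (measurableTypeR R)) : measurable_fun A f by exact: measurable_funTS.
pose I a b := \int[mu]_(x in `[a, b[) f x.
have Icc a b : \int[mu]_(x in `[a, b]) f x = I a b.
  by rewrite /I -integral_itv_bndo_bndc; last exact: mfS.
have Isplit a b d : (a <= b)%R -> (b <= d)%R -> I a d = I a b + I b d.
  move=> ab bd; rewrite /I (_ : [set` `[a, d[%R] = `[a, b[ `|` `[b, d[).
    rewrite ge0_integral_setU//=.
    apply/disj_setPS => x [/=]; rewrite !in_itv/= => /andP[_ xb] /andP[bx _].
    by have := lt_le_trans xb bx; rewrite ltxx.
  by rewrite -(@itv_bndbnd_setU _ _ _ (BLeft b)) ?bnd_simp.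
have I1 a b : I (a + 1)%R (b + 1)%R = I a b.
  by rewrite -!Icc -ge0_integral_shift//; apply: eq_integral => x _; exact: f1.
have IS a : I (a + 1)%R (a + 1 + 1)%R = I a (a + 1)%R by rewrite I1.
have In (n : nat) a : I (a + n%:R)%R (a + n%:R + 1)%R = I a (a + 1)%R.
  elim: n => [|n IH]; first by rewrite addr0.
  by rewrite -natr1 addrA IS.
have Iz (z : int) a : I (a + z%:~R)%R (a + z%:~R + 1)%R = I a (a + 1)%R.
  case: z => n; first exact: In.
  rewrite -(In n.+1 (a + (Negz n)%:~R)%R) NegzE mulrNz.
  by congr I; lra.
have Ir r : (0 <= r <= 1)%R -> I r (r + 1)%R = I 0%R 1%R.
  move=> /andP[r0 r1].
  rewrite (@Isplit _ 1%R)//; last by rewrite ler_wpDl.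
  by rewrite (@Isplit 0%R r 1%R)// [RHS]addeC -(I1 0%R r) add0r.
rewrite !Icc; set m := Num.floor c; set r := (c - m%:~R)%R.
have -> : c = (r + m%:~R)%R by rewrite /r; lra.
have := floor_itv c; rewrite intrD1.
by move=> /andP[? ?]; rewrite Iz Ir// /r /m; apply/andP; split; lra.
Qed.

Notation half := (2^-1 : R)%R.

Lemma integral_uniform_half (f : measurableTypeR R -> \bar R) :
  measurable_fun [set: measurableTypeR R] f -> (forall x, 0 <= f x) ->
  \int[uniform_prob (@half_ltN R)]_x f x = \int[mu]_(x in `[(- half)%R, half]) f x.
Proof.
move=> mf f0; rewrite integral_uniform// (_ : (_ - _ = 1)%R) ?invr1 ?mul1e//.
by lra.
Qed.

Lemma ge0_integral_uniform_reflect (c : R) (f : measurableTypeR R -> \bar R) :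
  measurable_fun [set: measurableTypeR R] f -> (forall x, 0 <= f x) ->
  (forall x, f (x + 1)%R = f x) ->
  \int[uniform_prob (@half_ltN R)]_x f (c - x)%R =
  \int[uniform_prob (@half_ltN R)]_x f x.
Proof.
move=> mf f0 f1; rewrite !integral_uniform_half//; last first.
  by apply: measurableT_comp => //; exact: measurable_funB.
rewrite ge0_integral_reflect//.
have -> : (c - - half = c - half + 1)%R by lra.
have -> : \int[mu]_(x in `[(- half)%R, half]) f x =
    \int[mu]_(x in `[(- half)%R, (- half + 1)%R]) f x.
  by have -> : (- half + 1 = half)%R by lra.
by rewrite !ge0_integral_shift_periodic.
Qed.

End torus_invariance.

(** * Invariance in dimension n, by slicing off the first coordinate *)

Section torus_reflect.
Context (R : realType).
Local Open Scope ereal_scope.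
Notation mu := (@lebesgue_measure R).

Definition rV_behead n (x : 'rV[R]_n.+1) : 'rV[R]_n :=
  \row_j x ord0 (lift ord0 j).

Lemma rV_cons0 n (p : R * 'rV[R]_n) : rV_cons p ord0 ord0 = p.1.
Proof. by rewrite mxE unlift_none. Qed.

Lemma rV_consS n (p : R * 'rV[R]_n) j : rV_cons p ord0 (lift ord0 j) = p.2 ord0 j.
Proof. by rewrite mxE liftK. Qed.

Lemma rV_consK n (x : 'rV[R]_n.+1) : rV_cons (x ord0 ord0, rV_behead x) = x.
Proof.
apply/rowP => i; case: (unliftP ord0 i) => [j|] ->; last by rewrite rV_cons0.
by rewrite rV_consS mxE.
Qed.

Lemma rV_consD n (a b : R) (x y : 'rV[R]_n) :
  (rV_cons (a, x) + rV_cons (b, y) = rV_cons (a + b, x + y))%R.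
Proof.
apply/rowP => i; rewrite mxE.
by case: (unliftP ord0 i) => [j|] ->; rewrite ?rV_cons0 ?rV_consS// mxE.
Qed.

Lemma rV_consZ n (c a : R) (x : 'rV[R]_n) :
  (c *: rV_cons (a, x) = rV_cons (c * a, c *: x))%R.
Proof.
apply/rowP => i; rewrite mxE.
by case: (unliftP ord0 i) => [j|] ->; rewrite ?rV_cons0 ?rV_consS// mxE.
Qed.

Lemma rV_consB n (a b : R) (x y : 'rV[R]_n) :
  (rV_cons (a, x) - rV_cons (b, y) = rV_cons (a - b, x - y))%R.
Proof. by rewrite -scaleN1r rV_consZ rV_consD scaleN1r mulN1r. Qed.

Lemma delta_rV_cons0 n : delta_mx ord0 ord0 = rV_cons (1%R, 0%R : 'rV[R]_n).
Proof.
apply/rowP => i; case: (unliftP ord0 i) => [j|] ->; rewrite ?rV_cons0 ?rV_consS.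
  by rewrite !mxE eqxx eq_sym (negbTE (neq_lift _ _)).
by rewrite mxE !eqxx.
Qed.

Lemma delta_rV_consS n (j : 'I_n) :
  delta_mx ord0 (lift ord0 j) = rV_cons (0%R, delta_mx ord0 j : 'rV[R]_n).
Proof.
apply/rowP => i; case: (unliftP ord0 i) => [k|] ->; rewrite ?rV_cons0 ?rV_consS.
  by rewrite !mxE (inj_eq lift_inj).
by rewrite mxE (negbTE (neq_lift _ _)) andbF.
Qed.

Lemma ge0_integral_torusS n (f : 'rV[R]_n.+1 -> \bar R) :
  measurable_fun setT f -> (forall x, 0 <= f x) ->
  \int[torus R n.+1]_x f x = \int[uniform_prob (@half_ltN R)]_s
    \int[torus R n]_y f (rV_cons (s, y)).
Proof.
move=> mf f0; rewrite /= ge0_integral_distribution//.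
rewrite (@fubini_tonelli1 _ _ _ _ R (uniform_prob (@half_ltN R)) (torus R n))//.
  by apply: measurableT_comp => //; exact: measurable_rV_cons.
by move=> p; exact: f0.
Qed.

Lemma measurable_fun_subr_rV n (x : 'rV[R]_n) :
  measurable_fun setT (fun y : 'rV[R]_n => x - y)%R.
Proof.
apply: measurable_fun_rV => i; under eq_fun do rewrite !mxE.
by apply: measurable_funB => //; exact: measurable_rV_coord.
Qed.

(** Induction on the dimension with Tonelli: for a fixed first coordinate the inner integral is
    reflected by induction, and the result, periodic in the first coordinate, is reflected on the
    line. Reflection is the basic symmetry because it is the change of variables in a
    convolution. *)
Lemma ge0_integral_torus_reflect n (x : 'rV[R]_n) (f : 'rV[R]_n -> \bar R) :
  measurable_fun setT f -> (forall y, 0 <= f y) ->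
  (forall i y, f (y + delta_mx ord0 i)%R = f y) ->
  \int[torus R n]_y f (x - y)%R = \int[torus R n]_y f y.
Proof.
elim: n => [|n IH] in x f *.
  by move=> _ _ _; apply: eq_integral => y _; rewrite !thinmx0.
move=> mf f0 f1; rewrite !ge0_integral_torusS//; last first.
  by apply: measurableT_comp => //; exact: measurable_fun_subr_rV.
have mfc : measurable_fun [set: measurableTypeR R * 'rV[R]_n] (fun p => f (rV_cons p)).
  by apply: measurableT_comp => //; exact: measurable_rV_cons.
pose F (s : measurableTypeR R) := \int[torus R n]_y f (rV_cons (s, y)).
transitivity (\int[uniform_prob (@half_ltN R)]_s F (x ord0 ord0 - s)%R).
  apply: eq_integral => s _.
  rewrite /F -(IH (rV_behead x) (fun y => f (rV_cons (x ord0 ord0 - s, y)%R))).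
  - by apply: eq_integral => y _; rewrite -rV_consB rV_consK.
  - exact: (measurableT_comp mfc (measurable_pair1 _)).
  - by move=> y; exact: f0.
  - move=> i y; rewrite -[RHS](f1 (lift ord0 i)) delta_rV_consS rV_consD.
    by rewrite addr0.
apply: ge0_integral_uniform_reflect.
- by apply: (@measurable_fun_fubini_tonelli_F _ _ _ _ R (torus R n) _ mfc) => p; exact: f0.
- by move=> s; exact: integral_ge0.
- move=> s; apply: eq_integral => y _.
  by rewrite -[RHS](f1 ord0) delta_rV_cons0 rV_consD addr0.
Qed.

End torus_reflect.


(* [torus_periodic] for codomains, such as [\bar R], that are not [zmodType]s. *)
Definition torus_invariant (R : realType) n (W : Type) (f : 'rV[R]_n -> W) :=
  forall i y, f (y + delta_mx ord0 i) = f y.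

Section torus_reflect_real.
Context (R : realType) (n : nat).
Notation T := (torus R n).
Notation rV := 'rV[R]_n.

Lemma integral_torus_reflect (x : rV) (f : rV -> \bar R) :
  measurable_fun setT f -> torus_invariant f ->
  (\int[T]_y f (x - y)%R = \int[T]_y f y)%E.
Proof.
move=> mf f1; rewrite [LHS]integralE [RHS]integralE.
have H (g : rV -> \bar R) : measurable_fun setT g -> (forall y, 0 <= g y)%E ->
    torus_invariant g -> (\int[T]_y g (x - y)%R = \int[T]_y g y)%E.
  by move=> mg g0 g1; exact: ge0_integral_torus_reflect.
congr (_ - _)%E.
- rewrite -(H f^\+%E) => //.
  + by apply: eq_integral => y _; rewrite !funeposE.
  + exact: measurable_funepos.
  + by move=> i y; rewrite !funeposE f1.
- rewrite -(H f^\-%E) => //.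
  + by apply: eq_integral => y _; rewrite !funenegE.
  + exact: measurable_funeneg.
  + by move=> i y; rewrite !funenegE f1.
Qed.

Lemma Rintegral_torus_reflect (x : rV) (f : rV -> R) :
  measurable_fun setT f -> torus_invariant f ->
  \int[T]_y f (x - y) = \int[T]_y f y.
Proof.
move=> mf f1; rewrite /Rintegral (integral_torus_reflect x (f := EFin \o f))//.
  exact/measurable_EFinP.
by move=> i y /=; rewrite f1.
Qed.

Lemma Rintegral_torus_shift (x : rV) (f : rV -> R) :
  measurable_fun setT f -> torus_invariant f ->
  \int[T]_y f (y + x) = \int[T]_y f y.
Proof.
move=> mf f1.
have fN : torus_invariant (fun y => f (- y)).
  by move=> i y; rewrite -[LHS](f1 i) opprD subrK.
have mN : measurable_fun setT (fun y : rV => f (- y)).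
  rewrite (_ : (fun y : rV => _) = fun y : rV => f (0 - y)); last first.
    by apply/funext => y; rewrite sub0r.
  exact: (measurableT_comp mf (@measurable_fun_subr_rV R n 0)).
have <- : \int[T]_y f (- y) = \int[T]_y f y.
  rewrite -(Rintegral_torus_reflect 0 mf f1); apply: eq_Rintegral => y _.
  by rewrite sub0r.
rewrite -(Rintegral_torus_reflect (- x) mN fN); apply: eq_Rintegral => y _.
by congr f; rewrite opprB opprK.
Qed.

Lemma integrable_bounded_torus (M : R) (f : rV -> R) :
  measurable_fun setT f -> (forall x, `|f x| <= M) ->
  T.-integrable setT (EFin \o f).
Proof.
move=> mf fM; apply: measurable_bounded_integrable => //.
  by rewrite (le_lt_trans (probability_le1 (torus R n) measurableT))// ltry.
exists M; split; first by rewrite num_real.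
by move=> y My x _ /=; rewrite (le_trans (fM x))// ltW.
Qed.

Lemma Rintegral_torus_cst (c : R) : \int[T]_x c = c.
Proof. by rewrite Rintegral_cst//= [X in fine X](probability_setT (torus R n)) mulr1. Qed.

End torus_reflect_real.

(** * Iterated directional derivatives *)

Lemma ler_dist_half (R : realFieldType) (a b c e : R) :
  `|a - c| < e / 2 -> `|b - c| < e / 2 -> `|a - b| <= e.
Proof.
rewrite !ltr_norml ler_norml => /andP[? ?] /andP[? ?].
by apply/andP; split; lra.
Qed.

Section iterated_derivatives.
Context (R : realType).
Implicit Types (V W : normedModType R).

Definition Ds V (vs : seq V) (g : V -> R) : V -> R :=
  foldr (fun v h => 'D_v h) g vs.

Definition smooth V (U : set V) (g : V -> R) :=
  forall vs x, U x -> differentiable (Ds vs g) x.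

Lemma Ds_cat V (us vs : seq V) g : Ds (us ++ vs) g = Ds us (Ds vs g).
Proof. by rewrite /Ds foldr_cat. Qed.

Lemma smooth_Ds V U (vs : seq V) g : smooth U g -> smooth U (Ds vs g).
Proof. by move=> sg us x Ux; rewrite -Ds_cat; exact: sg. Qed.

Lemma smooth_D V U (v : V) g : smooth U g -> smooth U ('D_v g).
Proof. exact: (@smooth_Ds _ _ [:: v]). Qed.

Lemma smooth_continuous V U (g : V -> R) x :
  smooth U g -> U x -> {for x, continuous g}.
Proof. by move=> sg Ux; exact: differentiable_continuous (sg [::] x Ux). Qed.

Lemma smooth_derivable V U (g : V -> R) x v : smooth U g -> U x -> derivable g x v.
Proof. by move=> sg Ux; exact: diff_derivable (sg [::] x Ux). Qed.

Lemma eq_open_derive V U (f g : V -> R) x v : open U ->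
  (forall y, U y -> f y = g y) -> U x -> 'D_v f x = 'D_v g x.
Proof.
move=> oU fg Ux; apply: near_eq_derive.
by apply: filterS (open_nbhs_nbhs (conj oU Ux)) => y; exact: fg.
Qed.

(** An affine substitution with linear part [L] leaves the difference quotient literally unchanged,
    so the identity holds at the level of the definition. It serves for translations, reflections,
    lines, slices at a fixed time and slices at a fixed first coordinate. *)
Lemma derive_comp_affine V W (phi L : W -> V) (g : V -> R) (y w : W) :
  (forall h, phi (h *: w + y) = h *: L w + phi y) ->
  'D_w (g \o phi) y = 'D_(L w) g (phi y).
Proof.
by move=> phiL; rewrite /derive; under eq_fun do rewrite /= phiL.
Qed.

Lemma derivable_comp_affine V W (phi L : W -> V) (g : V -> R) (y w : W) :
  (forall h, phi (h *: w + y) = h *: L w + phi y) ->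
  derivable g (phi y) (L w) -> derivable (g \o phi) y w.
Proof.
by move=> phiL; rewrite /derivable; under [in X in _ -> X]eq_fun do rewrite /= phiL.
Qed.

Lemma Ds_comp_affine V W (phi L : W -> V) (g : V -> R) (ws : seq W) :
  (forall h w y, phi (h *: w + y) = h *: L w + phi y) ->
  Ds ws (g \o phi) = Ds (map L ws) g \o phi.
Proof.
move=> phiL; elim: ws => [//|w ws IH] /=; rewrite IH; apply/funext => y.
by rewrite (derive_comp_affine (L := L)).
Qed.

Lemma smooth_comp_affine V W (phi L : W -> V) (g : V -> R) U :
  (forall h w y, phi (h *: w + y) = h *: L w + phi y) ->
  (forall y, differentiable phi y) -> smooth U g -> smooth (phi @^-1` U) (g \o phi).
Proof.
move=> phiL dphi sg ws y Uy; rewrite (Ds_comp_affine _ _ phiL).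
by apply: differentiable_comp => //; exact: sg.
Qed.

Lemma is_derive_line V (g : V -> R) (p u : V) (s : R) :
  derivable g (p + s *: u) u ->
  is_derive s 1 (fun s => g (p + s *: u)) ('D_u g (p + s *: u)).
Proof.
move=> dg.
have phiL (h : R) : p + (h *: (1 : R) + s) *: u = h *: ((1 : R) *: u) + (p + s *: u).
  by rewrite scalerDl addrCA scale1r; congr (_ *: _ + _); rewrite /GRing.scale/= mulr1.
have := dg; rewrite -{2}(scale1r u) => dg1.
apply: DeriveDef.
  exact: (@derivable_comp_affine _ R (fun s : R => p + s *: u)
    (fun r : R => r *: u) g s 1 phiL dg1).
have := @derive_comp_affine _ R (fun s : R => p + s *: u)
  (fun r : R => r *: u) g s 1 phiL.
by rewrite scale1r.
Qed.

Lemma derive_MVT V (g : V -> R) (p u : V) (h : R) : 0 <= h ->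
  (forall s, 0 <= s <= h -> derivable g (p + s *: u) u) ->
  exists2 s, 0 <= s <= h & g (p + h *: u) - g p = h * 'D_u g (p + s *: u).
Proof.
move=> h0 dg.
have [||s sh] := @MVT_segment R (fun s => g (p + s *: u))
  (fun s => 'D_u g (p + s *: u)) 0 h h0.
- move=> s; rewrite in_itv/= => /andP[/ltW s0 /ltW sh].
  by apply/is_derive_line/dg/andP.
- apply: derivable_within_continuous => s; rewrite in_itv/= => sh.
  by have [] := is_derive_line (dg s sh).
by rewrite scale0r addr0 subr0 mulrC => e; exists s => //; rewrite in_itv/= in sh.
Qed.

Definition second_difference V (g : V -> R) x (u v : V) h :=
  g (x + h *: u + h *: v) - g (x + h *: u) - (g (x + h *: v) - g x).

(** The mean value theorem is applied twice: along u to the increment of g in direction v, then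
    along v to the derivative of g in direction u. *)
Lemma second_difference_derive V (g : V -> R) (U : set V) x u v h :
  0 <= h -> smooth U g ->
  (forall s t, 0 <= s <= h -> 0 <= t <= h -> U (x + s *: u + t *: v)) ->
  exists s t, [/\ 0 <= s <= h, 0 <= t <= h &
    second_difference g x u v h = h * (h * 'D_v ('D_u g) (x + s *: u + t *: v))].
Proof.
move=> h0 sg Ust; have hh : 0 <= h <= h by rewrite h0 lexx.
have h00 : 0 <= (0 : R) <= h by apply/andP; split.
pose g' y := g (y + h *: v) - g y.
have dshift y : derivable g (y + h *: v) u -> derivable (fun y => g (y + h *: v)) y u.
  apply: (@derivable_comp_affine _ _ (fun y => y + h *: v) id) => k.
  by rewrite addrA.
have Dshift y : 'D_u (fun y => g (y + h *: v)) y = 'D_u g (y + h *: v).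
  apply: (@derive_comp_affine _ _ (fun y => y + h *: v) id) => k.
  by rewrite addrA.
have Us s : 0 <= s <= h -> U (x + s *: u).
  by move=> sh; have := Ust s 0 sh h00; rewrite scale0r addr0.
have [s sh|s sh es] := @derive_MVT V g' x u h h0.
  apply: derivableB; last exact: smooth_derivable sg (Us _ sh).
  by apply: dshift; apply: smooth_derivable sg (Ust _ _ sh hh).
have [t th|t th et] := @derive_MVT V ('D_u g) (x + s *: u) v h h0.
  exact: smooth_derivable (smooth_D _ sg) (Ust _ _ sh th).
exists s, t; split => //; rewrite -et /second_difference.
rewrite -[LHS]/(g' (x + h *: u) - g' x) es deriveB ?Dshift//.
  by apply: dshift; apply: smooth_derivable sg (Ust _ _ sh hh).
exact: smooth_derivable sg (Us _ sh).
Qed.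

Lemma continuous_pair_ball V (U : set V) (F G : V -> R) x e : 0 < e -> nbhs x U ->
  {for x, continuous F} -> {for x, continuous G} ->
  exists2 d, 0 < d & forall y, ball x d y ->
    [/\ U y, `|F x - F y| < e & `|G x - G y| < e].
Proof.
move=> e0 Ux /cvgrPdist_lt/(_ _ e0) c1 /cvgrPdist_lt/(_ _ e0) c2.
have : nbhs x (U `&` ([set y | `|F x - F y| < e] `&` [set y | `|G x - G y| < e])).
  exact: filterI Ux (filterI c1 c2).
move=> /nbhs_ballP[d /= d0 dU].
by exists d => // y /dU[? []].
Qed.

(** Schwarz's theorem. The second difference is symmetric in u and v, so the two mixed derivatives
    agree at two points close to x; continuity of both brings the points to x. *)
Lemma derive_commute V (U : set V) (g : V -> R) x u v : open U -> smooth U g ->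
  U x -> 'D_u ('D_v g) x = 'D_v ('D_u g) x.
Proof.
move=> oU sg Ux; have oUx := open_nbhs_nbhs (conj oU Ux).
apply/eqP; rewrite -subr_eq0 -normr_le0; apply/ler_addgt0Pl => e e0.
rewrite addr0.
have e20 : 0 < e / 2 by rewrite divr_gt0.
have [d d0 dU] := continuous_pair_ball e20 oUx
  (smooth_continuous (smooth_D u (smooth_D v sg)) Ux)
  (smooth_continuous (smooth_D v (smooth_D u sg)) Ux).
(* With h = d / (2m), every point x + s u + t v with s, t in [0, h] is at distance at most d / 2
   from x; the summand 1 keeps m positive when u and v vanish. *)
pose m := `|u| + `|v| + 1.
have m0 : 0 < m by rewrite ltr_pwDr.
pose h := d / (2 * m).
have h0 : 0 < h by rewrite divr_gt0// mulr_gt0.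
have bh (u' v' : V) s t : `|u'| + `|v'| + 1 = m -> 0 <= s <= h -> 0 <= t <= h ->
    ball x d (x + s *: u' + t *: v').
  move=> em /andP[s0 sh] /andP[t0 th]; rewrite -ball_normE /ball_/=.
  rewrite -addrA opprD addNKr normrN (le_lt_trans (ler_normD _ _))// !normrZ.
  rewrite (ger0_norm s0) (ger0_norm t0).
  apply: (@le_lt_trans _ _ (h * (`|u'| + `|v'|))).
    by rewrite mulrDr lerD// ler_wpM2r.
  apply: (@le_lt_trans _ _ (h * m)); first by rewrite -em ler_wpM2l ?ltW//; lra.
  have -> : h * m = d / 2 by rewrite /h; field; lra.
  by rewrite ltr_pdivrMr// ltr_pMr// ltr1n.
have em1 : `|u| + `|v| + 1 = m by [].
have em2 : `|v| + `|u| + 1 = m by rewrite (addrC `|v|).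
have [s t sh th|s [t [sh th]]] := @second_difference_derive V g U x u v h (ltW h0) sg.
  by have [] := dU _ (bh _ _ _ _ em1 sh th).
have [s' t' sh' th'|s' [t' [sh' th' e2]]] := @second_difference_derive V g U x v u h (ltW h0) sg.
  by have [] := dU _ (bh _ _ _ _ em2 sh' th').
have -> : second_difference g x u v h = second_difference g x v u h.
  by rewrite /second_difference (addrAC x); lra.
rewrite e2 => /(mulfI (lt0r_neq0 h0))/(mulfI (lt0r_neq0 h0)) E.
have [_ _ d1] := dU _ (bh _ _ _ _ em1 sh th).
have [_ d2 _] := dU _ (bh _ _ _ _ em2 sh' th').
by rewrite E in d2; exact: ler_dist_half d2 d1.
Qed.

Lemma Ds_D V (U : set V) (g : V -> R) x u vs : open U -> smooth U g ->
  U x -> Ds vs ('D_u g) x = 'D_u (Ds vs g) x.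
Proof.
move=> oU sg; elim: vs x => [//|v vs IH] x Ux /=.
rewrite (derive_commute _ _ oU (smooth_Ds vs sg))//.
exact: (eq_open_derive _ oU).
Qed.

Lemma Ds_DT V (g : V -> R) u vs : smooth setT g ->
  Ds vs ('D_u g) = 'D_u (Ds vs g).
Proof. by move=> sg; apply/funext => x; exact: (Ds_D _ _ openT sg). Qed.

Lemma DsB V (f g : V -> R) vs : smooth setT f -> smooth setT g ->
  Ds vs (f \- g) = Ds vs f \- Ds vs g.
Proof.
move=> sf sg; elim: vs => [//|v vs IH] /=; rewrite IH; apply/funext => x.
rewrite -[LHS]/('D_v (Ds vs f - Ds vs g) x) deriveB//.
  exact: smooth_derivable (smooth_Ds _ sf) _.
exact: smooth_derivable (smooth_Ds _ sg) _.
Qed.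

Lemma smoothB V (f g : V -> R) : smooth setT f -> smooth setT g ->
  smooth setT (f \- g).
Proof.
move=> sf sg vs x _; rewrite DsB//.
by apply: differentiableB; [exact: sf|exact: sg].
Qed.

Lemma Ds_sum V n (F : 'I_n -> V -> R) vs : (forall i, smooth setT (F i)) ->
  Ds vs (fun x => \sum_i F i x) = fun x => \sum_i Ds vs (F i) x.
Proof.
move=> sF; elim: vs => [//|v vs IH] /=; rewrite IH; apply/funext => x.
rewrite (_ : (fun x => _) = \sum_i Ds vs (F i)); last first.
  by apply/funext => y; rewrite fct_sumE.
rewrite derive_sum// => i.
exact: smooth_derivable (smooth_Ds _ (sF i)) _.
Qed.

Lemma smooth_sum V n (F : 'I_n -> V -> R) : (forall i, smooth setT (F i)) ->
  smooth setT (fun x => \sum_i F i x).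
Proof.
move=> sF vs x _; rewrite Ds_sum// (_ : (fun x => _) = \sum_i Ds vs (F i)).
  by apply: differentiable_sum => i; exact: sF.
by apply/funext => y; rewrite fct_sumE.
Qed.

Lemma Ds_linear_dir V (U : set V) (g : V -> R) x (n : nat) (c : 'I_n -> R) (v : 'I_n -> V) :
  smooth U g -> U x -> 'D_(\sum_i c i *: v i) g x = \sum_i c i * 'D_(v i) g x.
Proof.
move=> sg Ux; have dg := sg [::] x Ux.
by rewrite deriveE//= linear_sum; apply: eq_bigr => i _; rewrite linearZ deriveE.
Qed.

End iterated_derivatives.

(** * Continuous and smooth functions on the torus *)

Lemma continuous_at_dist (R : realType) (V : normedModType R) (f : V -> R) (x : V) :
  (forall e, 0 < e -> exists2 d, 0 < d & forall y, ball x d y -> `|f x - f y| <= e) ->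
  {for x, continuous f}.
Proof.
move=> fx; apply/cvgrPdist_le => e /fx[d d0 xd].
by apply/nbhs_ballP; exists d.
Qed.

Section torus_functions.
Context (R : realType) (n : nat).
Notation rV := 'rV[R]_n.
Notation T := (torus R n).
Notation e_ i := (delta_mx ord0 i : rV).
Implicit Types (f g : rV -> R).

Lemma torus_periodic_fract (W : zmodType) (x : rV) :
  exists y : rV, (forall i, 0 <= y ord0 i <= 1) /\
    forall f : rV -> W, torus_periodic f -> f x = f y.
Proof.
pose z (i : 'I_n) := Num.floor (x ord0 i).
pose y : rV := x - \sum_i (z i)%:~R *: e_ i.
exists y; split.
  move=> i; rewrite !mxE summxE (bigD1 i)//= big1 ?addr0 => [|j ji]; last first.
    by rewrite !mxE eqxx eq_sym (negbTE ji) mulr0.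
  rewrite !mxE !eqxx mulr1.
  have := floor_itv (x ord0 i); rewrite intrD1 => /andP[? ?].
  by apply/andP; split; rewrite /z; lra.
move=> f pf.
have fn i (k : nat) u : f (u + k%:R *: e_ i) = f u.
  elim: k => [|k IH] in u *; first by rewrite scale0r addr0.
  by rewrite -natr1 scalerDl scale1r addrA pf IH.
have fz i (k : int) u : f (u + k%:~R *: e_ i) = f u.
  case: k => k; first exact: fn.
  by rewrite -(fn i k.+1 (u + _)) -addrA -scalerDl NegzE mulrNz addNr scale0r addr0.
suff H u : f (u + \sum_i (z i)%:~R *: e_ i) = f u.
  by rewrite -[RHS]H subrK.
move: u; elim/big_rec : _ => [u|i v _ IH u]; first by rewrite addr0.
by rewrite addrCA addrC fz IH.
Qed.

Lemma compact_unit_cube : compact [set x : rV | forall i, 0 <= x ord0 i <= 1].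
Proof.
rewrite (_ : [set x | _] = [set x : rV | forall i, [set` `[(0 : R), 1]] (x ord0 i)]).
  exact: (@rV_compact R n (fun=> [set` `[(0 : R), 1]]) (fun=> @segment_compact R 0 1)).
by apply/seteqP; split => x /= h i; have := h i; rewrite in_itv.
Qed.

(** Compactness of the product of [a, b] with the unit cube. It provides the constant dominating
    functions for differentiation under the integral; continuity is asked only over [a, b] because
    the solution is controlled only at nonnegative times. *)
Lemma periodic_family_bounded (a b : R) (g : R -> rV -> R) :
  (forall t x, a <= t <= b -> {for (t, x), continuous (fun p => g p.1 p.2)}) ->
  (forall t, a <= t <= b -> torus_periodic (g t)) ->
  exists2 M, 0 <= M & forall t x, a <= t <= b -> `|g t x| <= M.
Proof.
move=> cg pg.
have [ba|ab] := ltP b a.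
  by exists 0 => // t x /andP[at_ tb]; have := le_trans at_ tb; rewrite leNgt ba.
pose A : set (R * rV) := `[a, b] `*` [set x : rV | forall i, 0 <= x ord0 i <= 1].
have cA : compact A by apply: compact_setX; [exact: segment_compact|exact: compact_unit_cube].
have A0 : A !=set0.
  by exists (a, 0); split => /=; [rewrite in_itv/= lexx|move=> i; rewrite mxE lexx ler01].
have [|c _ Ac] := @compact_EVT_max _ R (fun p => `|g p.1 p.2|) A A0 cA.
  apply: continuous_in_subspaceT => -[t x] /set_mem[/= + _]; rewrite in_itv/= => tab.
  exact: (continuous_comp (cg t x tab) (@norm_continuous _ _ _)).
exists `|g c.1 c.2| => // t x tab.
have [y [y01 xy]] := torus_periodic_fract R x.
rewrite (xy (g t))//; last exact: pg.
by apply: (Ac (t, y)); rewrite inE; split => //=; rewrite in_itv.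
Qed.

Definition tcont f := torus_periodic f /\ continuous f.

Lemma tcont_bounded f : tcont f -> exists2 M, 0 <= M & forall x, `|f x| <= M.
Proof.
move=> [pf cf].
have [|//|M M0 fM] := @periodic_family_bounded 0 0 (fun=> f).
  move=> t x _; apply: (@continuous_comp _ _ _ (fun p : R * rV => p.2) f).
    exact: cvg_snd.
  exact: cf.
by exists M => // x; apply: (fM 0); rewrite lexx.
Qed.

Lemma tcont_measurable f : tcont f -> measurable_fun setT f.
Proof. by move=> [_ cf]; exact: continuous_measurable_rV. Qed.

Lemma tcont_integrable f : tcont f -> T.-integrable setT (EFin \o f).
Proof.
move=> cf; have [M _ fM] := tcont_bounded cf.
exact: (integrable_bounded_torus (tcont_measurable cf) fM).
Qed.

Lemma tcont_cst c : tcont (fun=> c).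
Proof. by split => [//|x]; exact: cst_continuous. Qed.

Lemma tcontD f g : tcont f -> tcont g -> tcont (fun x => f x + g x).
Proof.
move=> [pf cf] [pg cg]; split => [i x|x]; first by rewrite pf pg.
by apply: continuousD; [exact: cf|exact: cg].
Qed.

Lemma tcontN f : tcont f -> tcont (fun x => - f x).
Proof.
move=> [pf cf]; split => [i x|x]; first by rewrite pf.
by apply: continuousN; exact: cf.
Qed.

Lemma tcontB f g : tcont f -> tcont g -> tcont (fun x => f x - g x).
Proof. by move=> cf cg; apply: tcontD => //; exact: tcontN. Qed.

Lemma tcontM f g : tcont f -> tcont g -> tcont (fun x => f x * g x).
Proof.
move=> [pf cf] [pg cg]; split => [i x|x]; first by rewrite pf pg.
by apply: continuousM; [exact: cf|exact: cg].
Qed.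

Lemma tcontX f : tcont f -> tcont (fun x => f x ^+ 2).
Proof. by move=> cf; under eq_fun do rewrite expr2; exact: tcontM. Qed.

Lemma tcont_norm f : tcont f -> tcont (fun x => `|f x|).
Proof.
move=> [pf cf]; split => [i x|x]; first by rewrite pf.
exact: (continuous_comp (cf x) (@norm_continuous _ _ _)).
Qed.

Lemma tcont_sum I (r : seq I) (P : pred I) (F : I -> rV -> R) :
  (forall i, P i -> tcont (F i)) -> tcont (fun x => \sum_(i <- r | P i) F i x).
Proof.
move=> cF; elim: r => [|i r IH].
  by under eq_fun do rewrite big_nil; exact: tcont_cst.
have [Pi|/negbTE Pi] := boolP (P i); under eq_fun do rewrite big_cons Pi; last by [].
by apply: tcontD => //; exact: cF.
Qed.

Definition tint f := \int[T]_x f x.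

Lemma tint_cst c : tint (fun=> c) = c.
Proof. exact: Rintegral_torus_cst. Qed.

Lemma tintD f g : tcont f -> tcont g ->
  tint (fun x => f x + g x) = tint f + tint g.
Proof. by move=> cf cg; rewrite /tint RintegralD//; exact: tcont_integrable. Qed.

Lemma tintZ c f : tcont f -> tint (fun x => c * f x) = c * tint f.
Proof. by move=> cf; rewrite /tint RintegralZl//; exact: tcont_integrable. Qed.

Lemma tintN f : tcont f -> tint (fun x => - f x) = - tint f.
Proof.
by move=> cf; rewrite -mulN1r -tintZ//; congr tint; apply/funext => x; rewrite mulN1r.
Qed.

Lemma tintB f g : tcont f -> tcont g ->
  tint (fun x => f x - g x) = tint f - tint g.
Proof. by move=> cf cg; rewrite tintD ?tintN//; exact: tcontN. Qed.

Lemma tint_sum I (r : seq I) (P : pred I) (F : I -> rV -> R) :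
  (forall i, P i -> tcont (F i)) ->
  tint (fun x => \sum_(i <- r | P i) F i x) = \sum_(i <- r | P i) tint (F i).
Proof.
move=> cF; elim: r => [|i r IH].
  by under eq_fun do rewrite big_nil; rewrite tint_cst big_nil.
rewrite big_cons; have [Pi|/negbTE Pi] := boolP (P i).
  under eq_fun do rewrite big_cons Pi.
  rewrite tintD ?IH//; first exact: cF.
  exact: tcont_sum.
by under eq_fun do rewrite big_cons Pi.
Qed.

Lemma tint_le f g : tcont f -> tcont g -> (forall x, f x <= g x) -> tint f <= tint g.
Proof. by move=> cf cg fg; apply: le_Rintegral => //; exact: tcont_integrable. Qed.

Lemma tint_ge0 f : (forall x, 0 <= f x) -> 0 <= tint f.
Proof. by move=> f0; exact: Rintegral_ge0. Qed.

Lemma tint_shift f v : tcont f -> tint (fun x => f (x + v)) = tint f.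
Proof.
by move=> cf; apply: Rintegral_torus_shift; [exact: tcont_measurable|exact: cf.1].
Qed.

Lemma tint_reflect f v : tcont f -> tint (fun x => f (v - x)) = tint f.
Proof.
by move=> cf; apply: Rintegral_torus_reflect; [exact: tcont_measurable|exact: cf.1].
Qed.

Lemma tcont_shift f v : tcont f -> tcont (fun x => f (x + v)).
Proof.
move=> [pf cf]; split => [i x|x]; first by rewrite addrAC pf.
have cv : {for x, continuous (fun x : rV => x + v)}.
  by apply: continuousD; [exact: cvg_id|exact: cst_continuous].
exact: (continuous_comp cv (cf (x + v))).
Qed.

(* By translation invariance the integral of [x |-> f (x + s v)] does not
   depend on [s]; differentiate at [s = 0]. *)
Lemma tint_derive f v : (forall x, derivable f x v) -> tcont f -> tcont ('D_v f) ->
  tint ('D_v f) = 0.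
Proof.
move=> df cf cdf.
have [M M0 fM] := tcont_bounded cdf.
have dline x (s : R) := @is_derive_line R _ f x v s (df _).
have E s x : partial1of2 (fun s x => f (x + s *: v)) s x = 'D_v f (x + s *: v).
  by rewrite partial1of2E; have [] := dline x s.
have := @differentiation_under_integral R _ _ T (fun s x => f (x + s *: v)) setT
  measurableT 0 (-1) 1 _ _ _ (fun=> M) _ _ _.
rewrite (_ : (fun s : R => \int[T]_x f (x + s *: v)) = fun=> tint f); last first.
  by apply/funext => s; exact: tint_shift.
rewrite derive1_cst => H; rewrite [RHS]H.
- apply: eq_Rintegral => x _; rewrite E scale0r addr0//.
- by rewrite /= in_itv/= ltrN10 ltr01.
- by move=> s _; apply: tcont_integrable; exact: tcont_shift.
- by move=> s x _ _; have [] := dline x s.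
- by [].
- exact: (tcont_integrable (tcont_cst M)).
- by move=> s x _ _; rewrite E.
Qed.

Definition tsmooth f := torus_periodic f /\ smooth setT f.

Lemma tsmooth_tcont f : tsmooth f -> tcont f.
Proof. by move=> [pf sf]; split => // x; exact: smooth_continuous sf _. Qed.

Lemma tsmooth_Ds f vs : tsmooth f -> tsmooth (Ds vs f).
Proof.
move=> [pf sf]; split; last exact: smooth_Ds.
move=> i x.
have : Ds vs (f \o (fun x => x + e_ i)) = Ds (map id vs) f \o (fun x => x + e_ i).
  by apply: Ds_comp_affine => h w y; rewrite addrA.
rewrite map_id (_ : f \o _ = f); last by apply/funext => y /=; exact: pf.
by move=> /(congr1 (fun h => h x)).
Qed.

Lemma tsmooth_D f v : tsmooth f -> tsmooth ('D_v f).
Proof. exact: (@tsmooth_Ds f [:: v]). Qed.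

Lemma tsmooth_derivable f x v : tsmooth f -> derivable f x v.
Proof. by move=> [_ sf]; exact: smooth_derivable sf _. Qed.

Lemma tint_by_parts f g v : tsmooth f -> tsmooth g ->
  tint (fun x => f x * 'D_v g x) = - tint (fun x => 'D_v f x * g x).
Proof.
move=> sf sg; have cf := tsmooth_tcont sf; have cg := tsmooth_tcont sg.
have cdf := tsmooth_tcont (tsmooth_D v sf); have cdg := tsmooth_tcont (tsmooth_D v sg).
have dM : 'D_v (f * g) = fun x => f x * 'D_v g x + 'D_v f x * g x.
  apply/funext => x.
  rewrite (deriveM (@tsmooth_derivable f x v sf) (@tsmooth_derivable g x v sg)).
  by congr (_ + _); exact: mulrC.
apply/eqP; rewrite -addr_eq0 -tintD; [|exact: tcontM..].
rewrite -dM tint_derive//.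
- move=> x.
  exact: derivableM (@tsmooth_derivable f x v sf) (@tsmooth_derivable g x v sg).
- exact: tcontM.
- by rewrite dM; apply: tcontD; exact: tcontM.
Qed.

(** A uniform modulus of continuity survives integration against an integrable kernel, which is how
    convolutions are shown to be continuous. The l1 distance appears because the increment x - y is
    expanded in the standard basis. *)
Lemma tsmooth_lipschitz f : tsmooth f ->
  exists2 M, 0 <= M & forall x y, `|f x - f y| <= M * \sum_i `|x ord0 i - y ord0 i|.
Proof.
move=> sf.
have : forall i, exists M, forall x, `|'D_(e_ i) f x| <= M.
  by move=> i; have [M _] := tcont_bounded (tsmooth_tcont (tsmooth_D (e_ i) sf)); exists M.
move=> /choice[M fM].
have M0 i : 0 <= M i by exact: le_trans (normr_ge0 _) (fM i 0).
exists (\sum_i M i); first exact: sumr_ge0.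
move=> x y.
have [//|s _] := @derive_MVT R _ f y (x - y) 1 ler01; first by move=> s _; exact: tsmooth_derivable.
rewrite scale1r subrKC mul1r => ->.
rewrite [X in 'D_X _ _](row_sum_delta (x - y)) (Ds_linear_dir _ _ sf.2)//.
rewrite mulr_sumr (le_trans (ler_norm_sum _ _ _))// ler_sum// => i _.
rewrite normrM !mxE mulrC ler_wpM2r// (le_trans (fM i _))//.
by rewrite (bigD1 i)//= lerDl sumr_ge0.
Qed.

Lemma lipschitz_continuous_rV f M : 0 <= M ->
  (forall x y, `|f x - f y| <= M * \sum_i `|x ord0 i - y ord0 i|) -> continuous f.
Proof.
move=> M0 fM x; apply: (continuous_at_dist (V := rV)) => e e0.
have d0 : 0 < e / ((M + 1) * (n%:R + 1)).
  by rewrite divr_gt0// mulr_gt0// ltr_wpDl.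
exists (e / ((M + 1) * (n%:R + 1))) => //= y [_ xy].
rewrite (le_trans (fM x y))//.
apply: (@le_trans _ _ ((M + 1) * ((n%:R + 1) * (e / ((M + 1) * (n%:R + 1)))))).
  apply: ler_pM => //; [exact: sumr_ge0|by rewrite lerDl|].
  apply: (@le_trans _ _ (\sum_(i < n) e / ((M + 1) * (n%:R + 1)))).
    by apply: ler_sum => i _; exact/ltW/xy.
  by rewrite sumr_const card_ord -[leLHS]mulr_natl ler_wpM2r ?(ltW d0)// lerDl.
rewrite [leLHS](_ : _ = e)//; field; apply/andP; split; apply: lt0r_neq0; rewrite ltr_wpDl//.
Qed.

End torus_functions.

(** * Convolution with the kernel *)

(** The Cauchy-Schwarz inequality, as nonnegativity of the sum of squared deviations from the mean S
    / m. *)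
Lemma sqr_sum_le (R : realFieldType) I (r : seq I) (a : I -> R) :
  (\sum_(i <- r) a i) ^+ 2 <= (size r)%:R * \sum_(i <- r) a i ^+ 2.
Proof.
have [/size0nil ->|r0] := eqVneq (size r) 0%N.
  by rewrite !big_nil expr0n mulr0.
set S := \sum_(i <- r) a i; set m : R := (size r)%:R.
have m0 : 0 < m by rewrite ltr0n lt0n.
have : 0 <= \sum_(i <- r) (a i - S / m) ^+ 2 by apply: sumr_ge0 => i _; exact: sqr_ge0.
have -> : \sum_(i <- r) (a i - S / m) ^+ 2 =
    \sum_(i <- r) a i ^+ 2 - 2 * (S / m) * S + m * (S / m) ^+ 2.
  rewrite /m /S; move: (_ / _) => c.
  elim: r {r0 S m m0} => [|i r IH] /=; first by rewrite !big_nil; ring.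
  by rewrite !big_cons {}IH -natr1; ring.
have -> : forall Q, Q - 2 * (S / m) * S + m * (S / m) ^+ 2 = (m * Q - S ^+ 2) / m.
  by move=> Q; field; exact: lt0r_neq0.
by rewrite pmulr_lge0 ?invr_gt0// subr_ge0.
Qed.

Lemma sqr_sum_ord_le (R : realFieldType) n (a : 'I_n -> R) :
  (\sum_i a i) ^+ 2 <= n%:R * \sum_i a i ^+ 2.
Proof.
have sz : size (index_enum 'I_n) = n by rewrite /index_enum -enumT size_enum_ord.
by have := sqr_sum_le (index_enum 'I_n) a; rewrite sz.
Qed.

Section convolution.
Context (R : realType) (n : nat).
Notation rV := 'rV[R]_n.
Notation T := (torus R n).
Notation e_ i := (delta_mx ord0 i : rV).
Implicit Types (k f : rV -> R).

(** The roles of the two arguments are exchanged with respect to [torus_conv]: x occurs only in the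
    smooth factor, so that derivatives in x fall on [f] and never on the kernel. *)
Definition conv k f x := \int[T]_z (k z * f (x - z)).

Lemma tcont_reflect f x : tcont f -> tcont (fun z => f (x - z)).
Proof.
move=> [pf cf]; split => [i z|z].
  by rewrite -[LHS](pf i); congr f; rewrite opprD addrA subrK.
have cv : {for z, continuous (fun z : rV => x - z)}.
  by apply: continuousB; [exact: cst_continuous|exact: cvg_id].
exact: (continuous_comp cv (cf (x - z))).
Qed.

Lemma conv_integrable k f x : T.-integrable setT (EFin \o k) -> tcont f ->
  T.-integrable setT (fun z => (k z * f (x - z))%:E).
Proof.
move=> ik cf; have [M _ fM] := tcont_bounded cf.
have mf : measurable_fun setT (fun z : rV => f (x - z)).
  exact: tcont_measurable (tcont_reflect x cf).
have bf : [bounded f (x - z : rV) | z in [set: rV]].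
  exists M; split; first by rewrite num_real.
  by move=> y My z _ /=; rewrite (le_trans (fM (x - z)))// ltW.
under eq_fun do rewrite EFinM.
exact: (integrableMl measurableT ik mf bf).
Qed.

Lemma conv_le k f x M : T.-integrable setT (EFin \o k) -> tcont f ->
  (forall z, `|f z| <= M) -> `|conv k f x| <= M * \int[T]_z `|k z|.
Proof.
move=> ik cf fM; rewrite (le_trans (le_normr_Rintegral _ (conv_integrable x ik cf)))//.
rewrite -RintegralZl//; last exact: integrable_norm.
apply: le_Rintegral => //; first exact: integrable_norm (conv_integrable x ik cf).
  exact: (integrableZl measurableT _ (integrable_norm ik)).
by move=> z _; rewrite normrM mulrC ler_wpM2r.
Qed.

Lemma convB k f x y : T.-integrable setT (EFin \o k) -> tcont f ->
  conv k f x - conv k f y = \int[T]_z (k z * (f (x - z) - f (y - z))).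
Proof.
move=> ik cf; rewrite /conv -RintegralB//; try exact: conv_integrable.
by apply: eq_Rintegral => z _; rewrite mulrBr.
Qed.

Lemma tcont_conv k f : T.-integrable setT (EFin \o k) -> tsmooth f -> tcont (conv k f).
Proof.
move=> ik sf; have cf := tsmooth_tcont sf; split.
  move=> i x; apply: eq_Rintegral => z _; congr (_ * _).
  by rewrite addrAC; exact: sf.1.
have [M M0 fM] := tsmooth_lipschitz sf.
apply: (@lipschitz_continuous_rV _ _ _ (M * \int[T]_z `|k z|)) => [|x y].
  by rewrite mulr_ge0// Rintegral_ge0.
rewrite convB//.
have ci : T.-integrable setT (fun z => (k z * (f (x - z) - f (y - z)))%:E).
  under eq_fun do rewrite mulrBr EFinB.
  by apply: integrableB => //; exact: conv_integrable.
rewrite (le_trans (le_normr_Rintegral _ ci))//.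
rewrite mulrAC -RintegralZl//; last exact: integrable_norm.
apply: le_Rintegral => //; first exact: (integrable_norm ci).
  exact: (integrableZl measurableT _ (integrable_norm ik)).
move=> z _; rewrite normrM mulrC ler_wpM2r// (le_trans (fM _ _))//.
rewrite le_eqVlt; apply/orP; left; apply/eqP; congr (_ * _); apply: eq_bigr => i _.
by rewrite !mxE opprB addrA subrK.
Qed.

(** Differentiation under the integral sign, the derivative in s being dominated by [M * |k z|]
    where M bounds the derivative of f. *)
Lemma conv_derive k f x v : T.-integrable setT (EFin \o k) -> tsmooth f ->
  derivable (conv k f) x v /\ 'D_v (conv k f) x = conv k ('D_v f) x.
Proof.
move=> ik sf.
have [M M0 fM] := tcont_bounded (tsmooth_tcont (tsmooth_D v sf)).
pose F (s : R) z := k z * f (x + s *: v - z).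
have dF z (s : R) : is_derive s 1 (F ^~ z) (k z * 'D_v f (x + s *: v - z)).
  have := @is_derive_line R _ f (x - z) v s (tsmooth_derivable sf).
  under [X in is_derive _ _ X _]eq_fun do rewrite addrAC.
  rewrite addrAC => df.
  exact: is_deriveZ.
have E s z : partial1of2 F s z = k z * 'D_v f (x + s *: v - z).
  by rewrite partial1of2E; have [] := dF z s.
have H : h^-1 *: ((conv k f \o shift x) (h *: v) - conv k f x) @[h --> 0^'] -->
    conv k ('D_v f) x.
  have <- : \int[T]_z (partial1of2 F 0 z) = conv k ('D_v f) x.
    by apply: eq_Rintegral => z _; rewrite E scale0r addr0.
  have -> : (fun h : R => h^-1 *: ((conv k f \o shift x) (h *: v) - conv k f x)) =
      fun h : R => h^-1 *: (\int[T]_z F (h + 0) z - \int[T]_z F 0 z).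
    apply/funext => h; rewrite addr0 /F scale0r addr0 /=.
    by under [X in _ = _ *: (X - _)]eq_Rintegral do rewrite (addrC x).
  apply: (@cvg_differentiation_under_integral R _ _ T F setT measurableT 0 (-1) 1
    _ _ _ (fun z => M * `|k z|)).
  - by rewrite /= in_itv/= ltrN10 ltr01.
  - by move=> s _; exact: conv_integrable (tsmooth_tcont sf).
  - by move=> s z _ _; have [] := dF z s.
  - by move=> z; rewrite mulr_ge0.
  - exact: (integrableZl measurableT _ (integrable_norm ik)).
  - by move=> s z _ _; rewrite E normrM mulrC ler_wpM2r.
by split; [exact: cvgP H|exact: cvg_lim H].
Qed.

(** The torus has total mass 1, so the difference of the two sides is the variance of f. *)
Lemma tint_sqr_le f : tcont f -> tint f ^+ 2 <= tint (fun x => f x ^+ 2).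
Proof.
move=> cf; set m := tint f; have cf2 := tcontX cf; have cm := tcontX (tcont_cst n m).
have : 0 <= tint (fun x => (f x - m) ^+ 2) by apply: tint_ge0 => x; exact: sqr_ge0.
have -> : (fun x => (f x - m) ^+ 2) = fun x => (f x ^+ 2 - (2 * m) * f x) + m ^+ 2.
  by apply/funext => x; ring.
have cmf : tcont (fun x => (2 * m) * f x) by apply: tcontM => //; exact: tcont_cst.
rewrite tintD//; last exact: tcontB.
by rewrite tintB// tint_cst tintZ// -/m; lra.
Qed.

Lemma tsmooth_reflect f x : tsmooth f -> tsmooth (fun z => f (x - z)).
Proof.
move=> [pf sf]; split => [i z|].
  by rewrite -[LHS](pf i); congr f; rewrite opprD addrA subrK.
have := @smooth_comp_affine R _ rV (fun z => x - z) -%R f setT _ _ sf.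
rewrite preimage_setT; apply.
  by move=> h w y; rewrite opprD scalerN addrCA.
by move=> y; apply: differentiableB; [exact: differentiable_cst|exact: ex_diff].
Qed.

Lemma derive_reflect f x v z : tsmooth f ->
  'D_v (fun z => f (x - z)) z = - 'D_v f (x - z).
Proof.
move=> [_ sf]; have df := sf [::] (x - z) I.
have := @derive_comp_affine R _ rV (fun z => x - z) -%R f z v.
move=> -> => [|h]; last by rewrite opprD scalerN addrCA.
by rewrite !deriveE// linearN.
Qed.

(** Testing a distributional identity for the kernel against z to f(x - z) turns it into a pointwise
    identity for the convolution at x. *)
Lemma test_function_reflect f x : tsmooth f -> test_function (fun z => f (x - z)).
Proof.
move=> /(tsmooth_reflect x)[pf sf]; split => //; exists setT, (fun z => f (x - z)).
by split => //; exact: openT.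
Qed.

End convolution.

(** * Consequences of the distributional hypotheses on K *)

Section kernel.
Context (R : realType) (n : nat).
Notation rV := 'rV[R]_n.
Notation T := (torus R n).
Notation e_ i := (delta_mx ord0 i : rV).
Implicit Types (f : rV -> R) (K : rV -> rV) (V : rV -> 'M[R]_n).

(** The change of variables y to x - y on the torus; it relies on the periodicity of both
    factors. *)
Lemma torus_convE K f x i : torus_periodic K -> L1_field K -> tcont f ->
  torus_conv K f x ord0 i = conv (fun z => K z ord0 i) f x.
Proof.
move=> pK iK cf; rewrite mxE.
pose h z := K z ord0 i * f (x - z).
rewrite /conv -(@Rintegral_torus_reflect R n x h).
- by apply: eq_Rintegral => y _; rewrite /h subKr.
- apply: measurable_funM; first by have /integrableP[/measurable_EFinP] := iK i.
  exact: tcont_measurable (tcont_reflect x cf).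
- by move=> j y; rewrite /h (pK j); congr (_ * _); exact: (tcont_reflect x cf).1.
Qed.

Lemma conv_derive_reflect K f x i j : L1_field K -> tsmooth f ->
  conv (fun z => K z ord0 i) ('D_(e_ j) f) x =
  - \int[T]_z (K z ord0 i * partial j (fun z => f (x - z)) z).
Proof.
move=> iK sf; rewrite -mulN1r -RintegralZl//; last first.
  have := conv_integrable x (iK i) (tcontN (tsmooth_tcont (tsmooth_D (e_ j) sf))).
  by apply: eq_integrable => // z _; rewrite /partial /= derive_reflect.
apply: eq_Rintegral => z _; rewrite /partial derive_reflect//; ring.
Qed.

Lemma conv_div_free K f x : L1_field K -> weak_div_free K -> tsmooth f ->
  \sum_i conv (fun z => K z ord0 i) ('D_(e_ i) f) x = 0.
Proof.
move=> iK dK sf; rewrite -[RHS]oppr0 -[X in - X](dK _ (test_function_reflect x sf)) -sumrN.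
by apply: eq_bigr => i _; exact: conv_derive_reflect.
Qed.

Lemma Loo_norm_ae f : (Loo_norm f < +oo)%E ->
  exists2 M, 0 <= M & {ae T, forall x, `|f x| <= M}.
Proof.
(* The norm of exponent +oo is an essential supremum only on a space of positive measure; here the
   total mass is 1. *)
rewrite /Loo_norm unlock ifT => [|]; last first.
  by rewrite [ltRHS](probability_setT T) lte_fin.
move=> /(@ess_supr_bounded _ _ _ T (fun x => `|f x|))[M fM].
exists `|M| => //; apply: filterS fM => x fx.
exact: le_trans fx (ler_norm M).
Qed.

(** The bound on v holds only almost everywhere, so the comparison is made between integrals of
    nonnegative extended functions; integrability of the product is deduced from it. *)
Lemma Rintegral_ae_bound (v g : rV -> R) M : measurable_fun setT v ->
  0 <= M ->
  {ae T, forall x, `|v x| <= M} -> tcont g ->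
  `|\int[T]_z (v z * g z)| <= M * \int[T]_z `|g z|.
Proof.
move=> mv M0 vM cg; have mg := tcont_measurable cg.
have ig := integrable_norm (tcont_integrable cg).
have iMg := integrableZl measurableT M ig.
have mvg : measurable_fun setT (fun z => v z * g z) by exact: measurable_funM.
have mMg : measurable_fun setT (fun z => M * `|g z|).
  by apply: measurable_funM => //; exact: measurableT_comp.
have le : (\int[T]_z `|(v z * g z)%:E| <= \int[T]_z (M * `|g z|)%:E)%E.
  apply: ae_ge0_le_integral => //.
  - exact/measurable_EFinP/measurableT_comp.
  - by move=> z _; rewrite lee_fin mulr_ge0.
  - exact/measurable_EFinP.
  - by apply: filterS vM => z vz _; rewrite lee_fin normrM ler_wpM2r.
have /integrableP[_ Moo] := iMg.
have Moo' : (\int[T]_z (M * `|g z|)%:E < +oo)%E.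
  by move: Moo; under eq_integral do rewrite /= ger0_norm ?mulr_ge0//.
have ivg : T.-integrable setT (EFin \o (fun z => v z * g z)).
  by apply/integrableP; split; [exact/measurable_EFinP|exact: le_lt_trans le Moo'].
rewrite (le_trans (le_normr_Rintegral _ ivg))// -RintegralZl// fine_le//.
- exact: (integrable_fin_num measurableT (integrable_norm ivg)).
- exact: (integrable_fin_num measurableT iMg).
Qed.

(** Testing against the reflected f moves the derivative from V to f, so the component i of [K * f]
    is the sum over j of the convolutions of [V_ij] with the partial derivatives of f. *)
Lemma conv_Loo_bound K V : L1_field K -> weak_div_eq K V -> Loo_field V ->
  exists2 C, 0 <= C & forall i f x, tsmooth f ->
    conv (fun z => K z ord0 i) f x ^+ 2 <=
    C * \sum_j tint (fun z => 'D_(e_ j) f z ^+ 2).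
Proof.
move=> iK KV LV.
have /choice[m hm] : forall p : 'I_n * 'I_n,
    exists M, 0 <= M /\ {ae T, forall x, `|V x p.1 p.2| <= M}.
  by move=> p; have [M M0 fM] := Loo_norm_ae (LV p.1 p.2).2; exists M.
pose M := \sum_p m p.
have M0 : 0 <= M by apply: sumr_ge0 => p _; exact: (hm p).1.
have VM i j : {ae T, forall x, `|V x i j| <= M}.
  apply: filterS (hm (i, j)).2 => x /le_trans; apply.
  by rewrite /M (bigD1 (i, j))//= lerDl; apply: sumr_ge0 => p _; exact: (hm p).1.
(* The factor n comes from Cauchy-Schwarz over j. M is the sum of the essential bounds of all
   entries of V, hence a common bound. *)
exists (n%:R * M ^+ 2) => [|i f x sf]; first by rewrite mulr_ge0// sqr_ge0.
have sfD j := tsmooth_D (e_ j) sf.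
have -> : conv (fun z => K z ord0 i) f x =
    \sum_j \int[T]_z (V z i j * 'D_(e_ j) f (x - z)).
  rewrite [LHS](KV i _ (test_function_reflect x sf)) -sumrN; apply: eq_bigr => j _.
  have iV : T.-integrable setT (EFin \o (fun z => V z i j)).
    apply/integrableP; split; first by apply/measurable_EFinP; exact: (LV i j).1.
    have le : (\int[T]_z `|(V z i j)%:E| <= \int[T]_z M%:E)%E.
      apply: ae_ge0_le_integral => //.
      - by apply: measurableT_comp => //; apply/measurable_EFinP; exact: (LV i j).1.
      - by apply: filterS (VM i j) => z Vz _; rewrite lee_fin.
    apply: le_lt_trans le _; rewrite integral_cst//.
    by rewrite [X in (_ * X)%E](probability_setT T) mule1 ltry.
  rewrite -mulN1r -RintegralZl//; last first.
    have := conv_integrable x iV (tcontN (tsmooth_tcont (sfD j))).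
    by apply: eq_integrable => // z _; rewrite /partial /= derive_reflect.
  by apply: eq_Rintegral => z _; rewrite /partial derive_reflect//; ring.
rewrite (le_trans (sqr_sum_ord_le _))// -mulrA ler_wpM2l// mulr_sumr.
apply: ler_sum => j _.
have cg := tcont_reflect x (tsmooth_tcont (sfD j)).
have le := Rintegral_ae_bound (LV i j).1 M0 (VM i j) cg.
rewrite -(tint_reflect x (tcontX (tsmooth_tcont (sfD j)))).
apply: (@le_trans _ _ ((M * tint (fun z => `|'D_(e_ j) f (x - z)|)) ^+ 2)).
  by rewrite -[leLHS]real_normK ?num_real// ler_sqr ?nnegrE// mulr_ge0// tint_ge0.
rewrite exprMn ler_wpM2l ?sqr_ge0// (le_trans (tint_sqr_le (tcont_norm cg)))//.
by under eq_fun do rewrite real_normK ?num_real//.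
Qed.

End kernel.

(** * Energies *)

Lemma sum_tupleS (R : nmodType) (I : finType) m (F : seq I -> R) :
  \sum_(a : m.+1.-tuple I) F a = \sum_(a : m.-tuple I) \sum_i F (i :: a).
Proof.
rewrite pair_bigA/=.
rewrite (reindex (fun p : m.-tuple I * I => cons_tuple p.2 p.1))//=.
exists (fun t => (behead_tuple t, thead t)) => [[a i] _|t _] /=.
  by congr pair; apply/val_inj.
by rewrite [RHS]tuple_eta; exact: val_inj.
Qed.

Section energy.
Context (R : realType) (n : nat).
Notation rV := 'rV[R]_n.
Notation T := (torus R n).
Notation e_ i := (delta_mx ord0 i : rV).
Implicit Types (f g tau : rV -> R) (a : seq 'I_n).

Definition dd a f := Ds [seq e_ i | i <- a] f.

Lemma partialsE a f : partials a f = dd a f.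
Proof. by rewrite /dd /Ds foldr_map. Qed.

Lemma tsmooth_dd a f : tsmooth f -> tsmooth (dd a f).
Proof. exact: tsmooth_Ds. Qed.

Lemma tcont_dd a f : tsmooth f -> tcont (dd a f).
Proof. by move=> sf; exact/tsmooth_tcont/tsmooth_dd. Qed.

Lemma dd_D a f v : tsmooth f -> dd a ('D_v f) = 'D_v (dd a f).
Proof. by move=> [_ sf]; exact: Ds_DT. Qed.

(** Ordered tuples count a mixed derivative once per ordering. With these weights, the squared
    gradients of the derivatives of order m add up exactly to the energy of order m+1. *)
Definition energy m f := \sum_(a : m.-tuple 'I_n) tint (fun x => dd a f x ^+ 2).

Lemma energy_ge0 m f : 0 <= energy m f.
Proof. by apply: sumr_ge0 => a _; apply: tint_ge0 => x; exact: sqr_ge0. Qed.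

Lemma energyS m f : energy m.+1 f =
  \sum_(a : m.-tuple 'I_n) \sum_i tint (fun x => 'D_(e_ i) (dd a f) x ^+ 2).
Proof. exact: (sum_tupleS _ (fun a => tint (fun x => dd a f x ^+ 2))). Qed.

Lemma sum_D_dd_le_energy a f :
  \sum_i tint (fun x => 'D_(e_ i) (dd a f) x ^+ 2) <= energy (size a).+1 f.
Proof.
rewrite energyS (bigD1 (in_tuple a))//= lerDl; apply: sumr_ge0 => b _.
by apply: sumr_ge0 => i _; apply: tint_ge0 => x; exact: sqr_ge0.
Qed.

Lemma D_dd_le_energy a f i :
  tint (fun x => 'D_(e_ i) (dd a f) x ^+ 2) <= energy (size a).+1 f.
Proof.
apply: le_trans (sum_D_dd_le_energy a f); rewrite (bigD1 i)//= lerDl.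
by apply: sumr_ge0 => j _; apply: tint_ge0 => x; exact: sqr_ge0.
Qed.

Lemma energy1 f : energy 1 f = \sum_i tint (fun x => 'D_(e_ i) f x ^+ 2).
Proof.
rewrite energyS (eq_bigl (pred1 [tuple])); first by rewrite big_pred1_eq.
by move=> a; rewrite [a]tuple0; exact/esym/eqxx.
Qed.

Lemma tint_laplacian f : tsmooth f ->
  tint (fun x => f x * laplacian f x) = - \sum_i tint (fun x => 'D_(e_ i) f x ^+ 2).
Proof.
move=> sf; rewrite /laplacian; under eq_fun do rewrite mulr_sumr.
have sD i := tsmooth_D (e_ i) sf.
have cD i := tsmooth_tcont (sD i).
have cDD i := tsmooth_tcont (tsmooth_D (e_ i) (sD i)).
rewrite tint_sum => [|i _]; last exact: tcontM (tsmooth_tcont sf) (cDD i).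
rewrite -sumrN; apply: eq_bigr => i _.
rewrite (tint_by_parts (e_ i) sf (sD i)).
by under eq_fun do rewrite -expr2.
Qed.

Lemma tsmooth_laplacian f : tsmooth f -> tsmooth (laplacian f).
Proof.
move=> sf; split.
  move=> i x; apply: eq_bigr => j _.
  exact: (tsmooth_D (e_ j) (tsmooth_D (e_ j) sf)).1.
apply: smooth_sum => i.
exact: (tsmooth_D (e_ i) (tsmooth_D (e_ i) sf)).2.
Qed.

Lemma dd_laplacian a f : tsmooth f -> dd a (laplacian f) = laplacian (dd a f).
Proof.
move=> sf; rewrite /dd Ds_sum => [|i].
  apply/funext => x; apply: eq_bigr => i _.
  rewrite /partial Ds_DT; last exact: (tsmooth_D (e_ i) sf).2.
  by rewrite Ds_DT//; exact: sf.2.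
exact: (tsmooth_D (e_ i) (tsmooth_D (e_ i) sf)).2.
Qed.

Lemma tsmoothB f g : tsmooth f -> tsmooth g -> tsmooth (f \- g).
Proof.
move=> [pf sf] [pg sg]; split; last exact: smoothB.
by move=> i x /=; rewrite pf pg.
Qed.

(** All ways to share out the derivatives in [a] between two factors. Listing them with repetition
    replaces the multinomial coefficients of the Leibniz rule. *)
Fixpoint splits (I : Type) (a : seq I) : seq (seq I * seq I) :=
  if a is i :: a' then [seq (i :: p.1, p.2) | p <- splits a'] ++
                       [seq (p.1, i :: p.2) | p <- splits a']
  else [:: ([::], [::])].

Lemma size_splits I (a : seq I) : size (splits a) = (2 ^ size a)%N.
Proof. by elim: a => //= i a IH; rewrite size_cat !size_map IH expnS mul2n addnn. Qed.

Lemma splits_size (I : eqType) (a : seq I) p : p \in splits a ->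
  (size p.1 + size p.2 = size a)%N.
Proof.
elim: a p => [|i a IH] p /=; first by rewrite inE => /eqP ->.
by rewrite mem_cat => /orP[] /mapP[q /IH <- ->] /=; rewrite ?addnS.
Qed.

Lemma is_derive_sum_seq (V : normedModType R) I (r : seq I) (F : I -> V -> R) (F' : I -> R) x v :
  (forall i, is_derive x v (F i) (F' i)) ->
  is_derive x v (fun y => \sum_(i <- r) F i y) (\sum_(i <- r) F' i).
Proof.
move=> dF; elim: r => [|i r IH].
  rewrite big_nil; under eq_fun do rewrite big_nil.
  exact: is_derive_cst.
rewrite big_cons; under eq_fun do rewrite big_cons.
exact: is_deriveD.
Qed.

Lemma leibniz (k : 'I_n -> rV -> R) f a :
  (forall j, T.-integrable setT (EFin \o k j)) -> tsmooth f ->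
  dd a (fun x => \sum_j conv (k j) f x * 'D_(e_ j) f x) =
  fun x => \sum_j \sum_(p <- splits a)
    conv (k j) (dd p.1 f) x * 'D_(e_ j) (dd p.2 f) x.
Proof.
move=> ik sf; elim: a => [|i a IH].
  by apply/funext => x /=; apply: eq_bigr => j _; rewrite big_seq1.
rewrite /dd/= -/(dd a _) IH; apply/funext => x.
have dterm j (p : seq 'I_n * seq 'I_n) : is_derive x (e_ i)
    (fun y => conv (k j) (dd p.1 f) y * 'D_(e_ j) (dd p.2 f) y)
    (conv (k j) (dd (i :: p.1) f) x * 'D_(e_ j) (dd p.2 f) x +
     conv (k j) (dd p.1 f) x * 'D_(e_ j) (dd (i :: p.2) f) x).
  have [d1 e1] := conv_derive x (e_ i) (ik j) (tsmooth_dd p.1 sf).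
  have d2 : derivable ('D_(e_ j) (dd p.2 f)) x (e_ i).
    exact: (tsmooth_derivable (tsmooth_D (e_ j) (tsmooth_dd p.2 sf))).
  have e2 : 'D_(e_ i) ('D_(e_ j) (dd p.2 f)) x = 'D_(e_ j) (dd (i :: p.2) f) x.
    exact: (@derive_commute R rV setT (dd p.2 f) x (e_ i) (e_ j) openT
      (tsmooth_dd p.2 sf).2 I).
  have := is_deriveM (derivableP d1) (derivableP d2).
  rewrite e1 e2 => H; apply: is_derive_eq H _.
  by rewrite addrC; congr (_ + _); exact: mulrC.
have := is_derive_sum_seq (index_enum 'I_n) (fun j => is_derive_sum_seq (splits a) (dterm j)).
case=> _; rewrite /partial => ->; apply: eq_bigr => j _.
by rewrite /= big_cat !big_map/= -big_split.
Qed.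

End energy.

(** * Energy inequalities at a fixed time *)

Lemma ler_sum_size (R : numDomainType) (I : eqType) (r : seq I) (F : I -> R) B :
  (forall i, i \in r -> F i <= B) -> \sum_(i <- r) F i <= (size r)%:R * B.
Proof.
move=> FB; rewrite big_seq (le_trans (ler_sum _ FB))// -big_seq.
by elim: r {FB} => [|i r IH]; rewrite ?big_nil ?mul0r// big_cons -nat1r mulrDl mul1r lerD2l.
Qed.

Section energy_inequality.
Context (R : realType) (n : nat) (K : 'rV[R]_n -> 'rV[R]_n) (iK : L1_field K).
Notation rV := 'rV[R]_n.
Notation T := (torus R n).
Notation e_ i := (delta_mx ord0 i : rV).
Notation k_ j := (fun z : rV => K z ord0 j).
Implicit Types (f g tau : rV -> R) (a : seq 'I_n).

Definition transport f x := \sum_j conv (k_ j) f x * 'D_(e_ j) f x.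

(** Writing u = K * f, the divergence of u f^2 has integral zero and equals (div u) f^2 + 2 f (u .
    grad f), where div u vanishes. *)
Lemma tint_transport f : weak_div_free K -> tsmooth f ->
  tint (fun x => f x * transport f x) = 0.
Proof.
move=> dK sf; have cf := tsmooth_tcont sf.
have sD j := tsmooth_D (e_ j) sf.
have cD j := tsmooth_tcont (sD j).
have cu j := tcont_conv (iK j) sf.
have cuD j := tcont_conv (iK j) (sD j).
pose h j x := conv (k_ j) f x * (f x * f x).
pose h' j x := conv (k_ j) ('D_(e_ j) f) x * (f x * f x) +
  2 * (f x * (conv (k_ j) f x * 'D_(e_ j) f x)).
have dh j x : is_derive x (e_ j) (h j) (h' j x).
  have [d1 e1] := conv_derive x (e_ j) (iK j) sf.
  have df : derivable f x (e_ j) by exact: (tsmooth_derivable sf).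
  have := is_deriveM (derivableP d1) (is_deriveM (derivableP df) (derivableP df)).
  rewrite e1 => H; apply: is_derive_eq H _.
  by rewrite /h' fctE /GRing.scale/=; ring.
have h'E j : 'D_(e_ j) (h j) = h' j by apply/funext => x; have [] := dh j x.
have ch j : tcont (h j) by apply: tcontM (cu j) (tcontM cf cf).
have c1 j : tcont (fun x => conv (k_ j) ('D_(e_ j) f) x * (f x * f x)).
  exact: tcontM (cuD j) (tcontM cf cf).
have c2 j : tcont (fun x => f x * (conv (k_ j) f x * 'D_(e_ j) f x)).
  exact: tcontM cf (tcontM (cu j) (cD j)).
have c22 j : tcont (fun x => 2 * (f x * (conv (k_ j) f x * 'D_(e_ j) f x))).
  exact: tcontM (tcont_cst n 2) (c2 j).
have ch' j : tcont (h' j) by exact: tcontD (c1 j) (c22 j).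
have : tint (fun x => \sum_j h' j x) = 0.
  rewrite tint_sum => [|j _]; last exact: ch'.
  apply: big1 => j _; rewrite -h'E; apply: tint_derive (ch j) _.
    by move=> x; have [] := dh j x.
  by rewrite h'E.
have -> : (fun x => \sum_j h' j x) = fun x => 2 * (f x * transport f x).
  apply/funext => x; rewrite big_split/= -mulr_suml (conv_div_free x iK dK sf).
  by rewrite mul0r add0r -mulr_sumr -mulr_sumr.
rewrite tintZ; last first.
  rewrite (_ : (fun x => _) = fun x => \sum_j f x * (conv (k_ j) f x * 'D_(e_ j) f x)).
    by apply: tcont_sum => j _; exact: c2.
  by apply/funext => x; rewrite /transport mulr_sumr.
by move=> /eqP; rewrite mulf_eq0 pnatr_eq0/= => /eqP.
Qed.

(** Here and in [energy_step], [tau] stands for the time derivative of the solution, which reduces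
    the energy estimates to statements about a single time. *)
Lemma energy_base f tau : weak_div_free K -> tsmooth f -> tsmooth tau ->
  (forall x, tau x = laplacian f x - transport f x) ->
  tint (fun x => f x * tau x) = - energy 1 f.
Proof.
move=> dK sf st E.
(* Regularity of the nonlinear term is read off the equation, as a difference of two smooth
   functions, rather than from products of convolutions. *)
have sN : tsmooth (laplacian f \- tau) by apply: tsmoothB => //; exact: tsmooth_laplacian.
have NE : transport f = laplacian f \- tau.
  by apply/funext => x /=; rewrite E subKr.
have -> : (fun x => f x * tau x) =
    fun x => f x * laplacian f x - f x * transport f x.
  by apply/funext => x; rewrite E mulrBr.
have cf := tsmooth_tcont sf.
rewrite tintB.
- by rewrite tint_transport// subr0 tint_laplacian// energy1.
- exact: tcontM cf (tsmooth_tcont (tsmooth_laplacian sf)).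
- by rewrite NE; exact: tcontM cf (tsmooth_tcont sN).
Qed.

Lemma tint_mulr_le f g : tcont f -> tcont g ->
  2 * tint (fun x => f x * g x) <= tint (fun x => f x ^+ 2) + tint (fun x => g x ^+ 2).
Proof.
move=> cf cg; rewrite -tintZ; last exact: tcontM.
rewrite -tintD; [|exact: tcontX..].
apply: tint_le.
- by apply: tcontM (tcont_cst n 2) _; exact: tcontM.
- by apply: tcontD; exact: tcontX.
move=> x; rewrite -subr_ge0 (_ : _ - _ = (f x - g x) ^+ 2) ?sqr_ge0//; ring.
Qed.

Section step.
Context (lambda C : R) (C0 : 0 <= C)
  (convC : forall i f x, tsmooth f ->
    conv (k_ i) f x ^+ 2 <= C * \sum_j tint (fun z => 'D_(e_ j) f z ^+ 2))
  (m : nat) (M : R).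

Let N := \sum_i \int[T]_z `|K z ord0 i|.

(** The first summand serves the Leibniz terms with an undifferentiated velocity, the second those
    with a differentiated one. *)
Definition step_const := (lambda * N) ^+ 2 + C * M.

Lemma tint_leibniz_term f j (p : seq 'I_n * seq 'I_n) :
  (forall x, `|f x| <= lambda) -> tsmooth f ->
  (forall l, (1 <= l <= m)%N -> energy l f <= M) -> 0 <= M ->
  (size p.1 + size p.2 = m)%N ->
  tint (fun x => (conv (k_ j) (dd p.1 f) x * 'D_(e_ j) (dd p.2 f) x) ^+ 2) <=
  step_const * \sum_(1 <= l < m.+2) energy l f.
Proof.
move=> fl sf EM M0 sz; set S := \sum_(1 <= l < _) _.
have S0 : 0 <= S by apply: sumr_ge0 => l _; exact: energy_ge0.
have ES l : (1 <= l < m.+2)%N -> energy l f <= S.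
  move=> lm; rewrite /S (bigD1_seq l) ?iota_uniq ?mem_index_iota//= lerDl.
  apply: sumr_ge0 => i _; exact: energy_ge0.
have l0 : 0 <= lambda by exact: le_trans (normr_ge0 _) (fl 0).
have N0 : 0 <= N by apply: sumr_ge0 => i _; exact: Rintegral_ge0.
have cu := tcont_conv (iK j) (tsmooth_dd p.1 sf).
have cD := tsmooth_tcont (tsmooth_D (e_ j) (tsmooth_dd p.2 sf)).
have bound B : 0 <= B -> (forall x, conv (k_ j) (dd p.1 f) x ^+ 2 <= B) ->
    tint (fun x => (conv (k_ j) (dd p.1 f) x * 'D_(e_ j) (dd p.2 f) x) ^+ 2) <=
    B * energy (size p.2).+1 f.
  move=> B0 uB; apply: le_trans (_ : B * tint (fun x => 'D_(e_ j) (dd p.2 f) x ^+ 2) <= _).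
    rewrite -tintZ; last exact: tcontX.
    apply: tint_le.
    - exact/tcontX/tcontM.
    - exact: tcontM (tcont_cst n B) (tcontX cD).
    - by move=> x; rewrite exprMn ler_wpM2r// sqr_ge0.
  by rewrite ler_wpM2l// D_dd_le_energy.
rewrite /step_const mulrDl.
(* Undifferentiated velocity: its sup is at most [lambda * N], and the other factor contributes the
   energy of order m+1, which enters linearly. *)
have [p10|p10] := posnP (size p.1).
  have -> : p.1 = [::] by exact/size0nil.
  rewrite ler_wpDr//; first by rewrite !mulr_ge0.
  have := bound ((lambda * N) ^+ 2) (sqr_ge0 _).
  rewrite (size0nil p10) => /(_ _)/le_trans; apply.
    move=> x; rewrite -real_normK ?num_real// ler_sqr ?nnegrE ?mulr_ge0//.
    rewrite (le_trans (conv_le x (iK j) (tsmooth_tcont sf) fl))// ler_wpM2l//.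
    by rewrite /N (bigD1 j)//= lerDl sumr_ge0// => i _; exact: Rintegral_ge0.
  rewrite ler_wpM2l ?sqr_ge0// ES//=.
  by move: sz; rewrite p10 add0n => ->; rewrite ltnS leqnn.
rewrite ler_wpDl//; first by rewrite mulr_ge0// sqr_ge0.
(* Differentiated velocity: now [size p.2 < m], so the energy of order [(size p.2).+1] is at most M,
   and the one of order [(size p.1).+1] is a term of S. *)
have := bound (C * energy (size p.1).+1 f).
move=> /(_ _ _)/le_trans; apply.
- by rewrite mulr_ge0// energy_ge0.
- move=> x; rewrite (le_trans (convC _ _ (tsmooth_dd _ sf)))// ler_wpM2l//.
  exact: sum_D_dd_le_energy.
rewrite -!mulrA ler_wpM2l// mulrC ler_pM ?energy_ge0//.
- by apply: EM; rewrite /= -sz -[X in (X < _)%N]add0n ltn_add2r.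
- by apply: ES; rewrite !ltnS -sz leq_addr.
Qed.

(** For g of order m+1 with outermost direction i, the nonlinear part is the integral of g times the
    derivative in direction i of some w of order m. After integration by parts, Young's inequality
    bounds it by the squared norms of the derivative of g, absorbed by the dissipation, and of w. *)
Lemma energy_step f tau :
  (forall x, `|f x| <= lambda) -> tsmooth f -> tsmooth tau ->
  (forall x, tau x = laplacian f x - transport f x) ->
  (forall l, (1 <= l <= m)%N -> energy l f <= M) -> 0 <= M ->
  \sum_(a : m.+1.-tuple 'I_n) 2 * tint (fun x => dd a f x * dd a tau x) <=
  - energy m.+2 f + #|{: m.+1.-tuple 'I_n}|%:R * ((n%:R * (2 ^ m)%:R) ^+ 2 *
     (step_const * \sum_(1 <= l < m.+2) energy l f)).
Proof.
move=> fl sf st E EM M0.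
have sL := tsmooth_laplacian sf.
have NE : transport f = laplacian f \- tau.
  by apply/funext => x /=; rewrite E subKr.
have sN : tsmooth (transport f) by rewrite NE; exact: tsmoothB.
(* A is the number of Leibniz terms, n components times 2^m splittings. It enters squared: once from
   Cauchy-Schwarz, once from adding up equal bounds B. *)
set A := (n%:R * (2 ^ m)%:R : R); set B := step_const * _.
have wB (b : seq 'I_n) : size b = m -> tint (fun x => dd b (transport f) x ^+ 2) <= A ^+ 2 * B.
  move=> sb.
  pose F j (p : seq 'I_n * seq 'I_n) x :=
    conv (k_ j) (dd p.1 f) x * 'D_(e_ j) (dd p.2 f) x.
  have cF j p : tcont (F j p).
    apply: tcontM; first exact: tcont_conv (iK j) (tsmooth_dd p.1 sf).
    exact: tsmooth_tcont (tsmooth_D (e_ j) (tsmooth_dd p.2 sf)).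
  have cF2 j p := tcontX (cF j p).
  have cS j : tcont (fun x => \sum_(p <- splits b) F j p x ^+ 2).
    by apply: tcont_sum => p _; exact: cF2.
  have cSS : tcont (fun x => \sum_j \sum_(p <- splits b) F j p x ^+ 2).
    by apply: tcont_sum => j _; exact: cS.
  rewrite (leibniz b iK sf).
  apply: (@le_trans _ _ (tint (fun x => A * \sum_j \sum_(p <- splits b) F j p x ^+ 2))).
    apply: tint_le.
    - by apply/tcontX/tcont_sum => j _; apply: tcont_sum => p _; exact: cF.
    - exact: tcontM (tcont_cst n A) cSS.
    move=> x; apply: le_trans (sqr_sum_ord_le _) _.
    rewrite -mulrA ler_wpM2l// mulr_sumr; apply: ler_sum => j _.
    by apply: le_trans (sqr_sum_le _ _) _; rewrite size_splits sb.
  rewrite tintZ// expr2 -mulrA ler_wpM2l ?mulr_ge0// tint_sum => [|j _]; last exact: cS.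
  apply: (@le_trans _ _ (\sum_(j < n) (2 ^ m)%:R * B)).
    apply: ler_sum => j _; rewrite tint_sum => [|p _]; last exact: cF2.
    rewrite -sb -size_splits; apply: ler_sum_size => p /splits_size.
    by rewrite sb => sp; exact: tint_leibniz_term.
  by rewrite sumr_const card_ord -[leLHS]mulr_natl mulrA.
have termB (a : m.+1.-tuple 'I_n) : 2 * tint (fun x => dd a f x * dd a tau x) <=
    - (\sum_j tint (fun x => 'D_(e_ j) (dd a f) x ^+ 2)) + A ^+ 2 * B.
  case/tupleP: a => i b /=; set g := dd (i :: b) f.
  have sg : tsmooth g by exact: tsmooth_dd.
  have cg := tsmooth_tcont sg.
  have swb := tsmooth_dd b sN; set w := dd b _ in swb.
  have cw := tsmooth_tcont swb.
  have sDw := tsmooth_D (e_ i) swb; have sDg := tsmooth_D (e_ i) sg.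
  have cDw := tsmooth_tcont sDw; have cDg := tsmooth_tcont sDg.
  have sLg := tsmooth_laplacian sg.
  have -> : (fun x => g x * dd (i :: b) tau x) =
      fun x => g x * laplacian g x - g x * 'D_(e_ i) w x.
    have Dw : 'D_(e_ i) w = dd (i :: b) (laplacian f) \- dd (i :: b) tau.
      by rewrite /w NE; exact: (@DsB R rV _ _ [seq e_ j | j <- i :: b] sL.2 st.2).
    apply/funext => x; rewrite [X in _ - _ * X](congr1 (fun h => h x) Dw).
    rewrite -(dd_laplacian (i :: b) sf) -mulrBr.
    by rewrite subKr.
  rewrite tintB; [|exact: tcontM cg (tsmooth_tcont sLg)|exact: tcontM].
  rewrite tint_laplacian// (tint_by_parts (e_ i) sg swb).
  (* Here x is the full squared gradient of g, y its component i, z the squared norm of w, and q the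
     cross term; of the dissipation 2x one x is spent on y. *)
  have arith (x y z p q : R) : y <= x -> z <= p -> 2 * q <= y + z ->
      2 * (- x - - q) <= - x + p by lra.
  have le : tint (fun x => 'D_(e_ i) g x ^+ 2) <=
      \sum_j tint (fun x => 'D_(e_ j) g x ^+ 2).
    rewrite (bigD1 i)//= lerDl; apply: sumr_ge0 => j _.
    by apply: tint_ge0 => x; exact: sqr_ge0.
  exact: arith le (wB b (size_tuple b)) (tint_mulr_le cDg cw).
apply: (@le_trans _ _ (\sum_(a : m.+1.-tuple 'I_n)
    (- (\sum_j tint (fun x => 'D_(e_ j) (dd a f) x ^+ 2)) + A ^+ 2 * B))).
  by apply: ler_sum => a _; exact: termB.
rewrite big_split/= sumrN -energyS sumr_const -[X in _ + X]mulr_natl.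
by rewrite lerD2l.
Qed.

End step.
End energy_inequality.

(** * Time derivative of the energies *)

Lemma continuous_sum_seq (R : realType) (V : normedModType R) I (r : seq I)
    (F : I -> V -> R) :
  (forall i, continuous (F i)) -> continuous (fun y => \sum_(i <- r) F i y).
Proof.
move=> cF; elim: r => [|i r IH] y.
  by under eq_fun do rewrite big_nil; exact: cst_continuous.
under eq_fun do rewrite big_cons.
by apply: continuousD; [exact: cF|exact: IH].
Qed.

Section space_time.
Context (R : realType) (n : nat).
Notation rV := 'rV[R]_n.
Notation T := (torus R n).
Notation e_ i := (delta_mx ord0 i : rV).
Notation V := (R * 'rV[R]_n)%type.
Notation et := ((1, 0) : V).
Context (U : set V) (g : V -> R) (oU : open U) (sg : smooth U g)
  (posU : forall t x, 0 <= t -> U (t, x))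
  (pg : forall t, 0 <= t -> torus_periodic (fun x : rV => g (t, x))).
Implicit Types (a : seq 'I_n) (t : R) (x : rV).

Definition slice t x := g (t, x).
Definition tslice t x := 'D_et g (t, x).
Let ex a : seq V := [seq (0 : R, v) | v <- [seq e_ i | i <- a]].

Let pairxL t (h : R) (w y : rV) : (t, h *: w + y) = h *: ((0 : R, w) : V) + (t, y).
Proof. by congr pair => /=; rewrite scaler0 add0r. Qed.

Lemma Ds_slice (h : V -> R) vs t :
  Ds vs (fun x => h (t, x)) = fun x => Ds [seq (0 : R, v) | v <- vs] h (t, x).
Proof. exact: (@Ds_comp_affine R V rV (fun x => (t, x)) (fun w => (0, w)) h vs (pairxL t)). Qed.

Lemma smooth_slice (h : V -> R) t : 0 <= t -> smooth U h -> smooth setT (fun x => h (t, x)).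
Proof.
move=> t0 sh.
have dpair (y : rV) : differentiable (fun x : rV => (t, x) : V) y.
  apply: (@differentiable_pair R rV R rV (fun=> t) id y); last exact: ex_diff.
  exact: differentiable_cst.
have := @smooth_comp_affine R V rV (fun x => (t, x)) (fun w => (0, w)) h U (pairxL t) dpair sh.
by move=> H vs x _; apply: H; exact: posU.
Qed.

Lemma tsmooth_slice t : 0 <= t -> tsmooth (slice t).
Proof. by move=> t0; split; [exact: pg|exact: smooth_slice]. Qed.

Lemma dd_slice a t x : dd a (slice t) x = Ds (ex a) g (t, x).
Proof. by rewrite /dd Ds_slice. Qed.

Lemma dd_tslice_Ds a t x : dd a (tslice t) x = Ds (ex a) ('D_et g) (t, x).
Proof.
exact: (congr1 (fun h => h x) (Ds_slice ('D_et g) [seq e_ i | i <- a] t)).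
Qed.

Lemma dd_tslice a t x : 0 <= t -> dd a (tslice t) x = 'D_et (Ds (ex a) g) (t, x).
Proof.
by move=> t0; rewrite -(Ds_D et (ex a) oU sg (posU x t0)) dd_tslice_Ds.
Qed.

Let pairtL x (h w y : R) : (h *: w + y, x) = h *: ((w, 0) : V) + (y, x).
Proof. by congr pair => /=; rewrite scaler0 add0r. Qed.

Lemma is_derive_time (h : V -> R) t x : smooth U h -> 0 <= t ->
  is_derive t 1 (fun s => h (s, x)) ('D_et h (t, x)).
Proof.
move=> sh t0; have dh : derivable h (t, x) et.
  exact: smooth_derivable sh (posU x t0).
apply: DeriveDef.
  exact: (@derivable_comp_affine R V R (fun s => (s, x)) (fun w => (w, 0)) h t 1
    (fun k => pairtL x k 1 t) dh).
exact: (@derive_comp_affine R V R (fun s => (s, x)) (fun w => (w, 0)) h t 1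
    (fun k => pairtL x k 1 t)).
Qed.

(** Periodicity of the time derivative needs periodicity at all nearby times, known only on the
    nonnegative side; hence t > 0. *)
Lemma tsmooth_tslice t : 0 < t -> tsmooth (tslice t).
Proof.
move=> t0; split; last exact: smooth_slice (ltW t0) (smooth_D et sg).
move=> i x.
have [_ e1] := is_derive_time x sg (ltW t0).
have [_ e2] := is_derive_time (x + e_ i) sg (ltW t0).
rewrite /tslice -[RHS]e1 -[LHS]e2; apply: near_eq_derive.
have t00 : `]0, +oo[%classic t by rewrite /= in_itv/= t0.
have := open_nbhs_nbhs (conj (@interval_open R (BRight 0) +oo%O isT isT) t00).
apply: filterS => s; rewrite /= in_itv/= andbT => s0.
exact: (pg (ltW s0)).
Qed.

(* Only [s >= 0] matters; [`|s|] gives a continuous function on all of [R]. *)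
Lemma is_derive_energy_term a t : 0 < t ->
  is_derive t 1 (fun s => tint (fun x => dd a (slice `|s|) x ^+ 2))
    (2 * tint (fun x => dd a (slice t) x * dd a (tslice t) x)).
Proof.
move=> t0.
pose F (s : R) (x : rV) := dd a (slice `|s|) x ^+ 2.
pose F' (s : R) (x : rV) := 2 * (dd a (slice s) x * dd a (tslice s) x).
(* This neighbourhood of t has its closure in the positive times, where compactness gives a constant
   bound on the time derivative. *)
have I0 s : `]t / 2, t * 2[%classic s -> 0 < s.
  by rewrite /= in_itv/= => /andP[ts _]; apply: lt_trans ts; rewrite divr_gt0.
have cF s : tcont (F s).
  exact/tcontX/tcont_dd/tsmooth_slice.
have sH := smooth_Ds (ex a) sg.
have dF (s : R) (x : rV) : 0 < s -> is_derive s 1 (F ^~ x) (F' s x).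
  move=> s0.
  have := is_derive_time x sH (ltW s0) => dH.
  have := is_deriveM dH dH; rewrite -dd_tslice ?ltW// => dH2.
  have E : F' s x = Ds (ex a) g (s, x) *: dd a (tslice s) x +
      Ds (ex a) g (s, x) *: dd a (tslice s) x.
    by rewrite /F' dd_slice /GRing.scale/=; ring.
  rewrite E; apply: near_eq_is_derive dH2.
  have s00 : `]0, +oo[%classic s by rewrite /= in_itv/= s0.
  have := open_nbhs_nbhs (conj (@interval_open R (BRight 0) +oo%O isT isT) s00).
  apply: filterS => r; rewrite /= in_itv/= andbT => r0.
  by rewrite /F dd_slice gtr0_norm// expr2.
have [M M0 fM] : exists2 M, 0 <= M & forall s x, t / 2 <= s <= t * 2 -> `|F' s x| <= M.
  apply: periodic_family_bounded => [s x /andP[ts _]|s /andP[ts _]].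
    have s0 : 0 <= s by apply: le_trans ts; rewrite divr_ge0// ltW.
    rewrite (_ : (fun p : R * rV => F' p.1 p.2) =
        fun p => 2 * (Ds (ex a) g p * Ds (ex a) ('D_et g) p)); last first.
      by apply/funext => -[r y]; rewrite /F' dd_slice dd_tslice_Ds.
    have c1 := smooth_continuous (smooth_Ds (ex a) sg) (posU x s0).
    have c2 := smooth_continuous (smooth_Ds (ex a) (smooth_D et sg)) (posU x s0).
    apply: continuousM; first exact: cst_continuous.
    exact: continuousM.
  have s0 : 0 < s by apply: lt_le_trans ts; rewrite divr_gt0.
  move=> i x; rewrite /F'.
  rewrite (tsmooth_dd a (tsmooth_slice (ltW s0))).1.
  by rewrite (tsmooth_dd a (tsmooth_tslice s0)).1.
have E : partial1of2 F t = F' t.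
  by apply/funext => x; rewrite partial1of2E; have [] := dF t x t0.
have It : `]t / 2, t * 2[%classic t by rewrite /= in_itv/=; apply/andP; split; lra.
have intF s : `]t / 2, t * 2[%classic s -> T.-integrable setT (EFin \o F s).
  by move=> _; exact: tcont_integrable.
have derF (s : R) (x : rV) : `]t / 2, t * 2[%classic s -> setT x -> derivable (F ^~ x) s 1.
  by move=> /I0 s0 _; have [] := dF s x s0.
have bF (s : R) (x : rV) : `]t / 2, t * 2[%classic s -> setT x -> `|partial1of2 F s x| <= M.
  move=> Is _; rewrite partial1of2E; have [_ ->] := dF s x (I0 _ Is).
  by apply: fM; move: Is; rewrite /= in_itv/= => /andP[/ltW -> /ltW ->].
have iM := tcont_integrable (tcont_cst n M).
apply: DeriveDef.
  exact: (derivable_under_integral measurableT It intF derF (fun=> M0) iM bF).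
rewrite -derive1E (differentiation_under_integral measurableT It intF derF (fun=> M0) iM bF).
rewrite -tintZ; last first.
  apply: tcontM; first exact: tcont_dd (tsmooth_slice (ltW t0)).
  exact: tcont_dd (tsmooth_tslice t0).
by apply: eq_Rintegral => x _; rewrite -/(F' t x) -E.
Qed.

(** Differentiability is available only for t > 0; continuity at 0 is what lets the initial value
    bound the later ones. *)
Lemma continuous_energy_term a :
  continuous (fun s : R => tint (fun x => dd a (slice `|s|) x ^+ 2)).
Proof.
move=> t.
pose F (s : R) (x : rV) := dd a (slice `|s|) x ^+ 2.
have cF s : tcont (F s) by exact/tcontX/tcont_dd/tsmooth_slice.
have c1 (s : R) (x : rV) : 0 <= s ->
    {for (s, x), continuous (fun p : R * rV => dd a (slice p.1) p.2 ^+ 2)}.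
  move=> s0; rewrite (_ : (fun p : R * rV => _) = fun p => Ds (ex a) g p * Ds (ex a) g p).
    by apply: continuousM; exact: smooth_continuous (smooth_Ds (ex a) sg) (posU x s0).
  by apply/funext => -[r y]; rewrite dd_slice expr2.
have [M M0 fM] : exists2 M, 0 <= M &
    forall s x, 0 <= s <= `|t| + 1 -> `|dd a (slice s) x ^+ 2| <= M.
  apply: (@periodic_family_bounded R n 0 (`|t| + 1) (fun s x => dd a (slice s) x ^+ 2)).
    by move=> s x /andP[s0 _]; exact: c1.
  by move=> s /andP[s0 _]; exact: (tcontX (tcont_dd a (tsmooth_slice s0))).1.
apply: (@continuity_under_integral R _ _ T F setT measurableT (t - 1) (t + 1) _ _ (fun=> M)).
- by move=> s _; exact: tcont_integrable.
- apply: aeW => x _ s _.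
  have cn : {for s, continuous (fun s : R => (`|s|, x) : R * rV)}.
    apply: (@cvg_pair _ _ _ (nbhs s) (nbhs `|s|) (nbhs x) _ _ _
      (fun s : R => `|s|) (fun=> x)).
      exact: norm_continuous.
    exact: cvg_cst.
  exact: (continuous_comp cn (c1 `|s| x (normr_ge0 _))).
- exact: (tcont_integrable (tcont_cst n M)).
- move=> s /=; rewrite in_itv/= => /andP[ts st]; apply: aeW => x _; apply: fM.
  rewrite normr_ge0/= -[X in `|X|](subrK t) (le_trans (ler_normD _ _))// addrC lerD2l.
  by rewrite ler_norml; apply/andP; split; lra.
- by rewrite inE /= in_itv/=; apply/andP; split; lra.
Qed.

Lemma continuous_energy m : continuous (fun s : R => energy m (slice `|s|)).
Proof. by apply: continuous_sum_seq => a; exact: continuous_energy_term. Qed.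

Lemma is_derive_energy m t : 0 < t ->
  is_derive t 1 (fun s : R => energy m (slice `|s|))
    (\sum_(a : m.-tuple 'I_n) 2 * tint (fun x => dd a (slice t) x * dd a (tslice t) x)).
Proof. by move=> t0; apply: is_derive_sum_seq => a; exact: is_derive_energy_term. Qed.

End space_time.

(** * Lyapunov functions *)

Lemma nonincreasing_derive (R : realType) (G : R -> R) (b : R) : 0 <= b ->
  {within `[0, b], continuous G} ->
  (forall t, 0 < t < b -> exists2 g', is_derive t 1 G g' & g' <= 0) ->
  G b <= G 0.
Proof.
move=> b0 cG dG.
apply: (@ler0_derive1_le_cc R G 0 b) => //.
- by move=> t; rewrite in_itv/= => /dG[g' []].
- by move=> t; rewrite in_itv/= => /dG[g' [? <-]]; rewrite derive1E.
- by rewrite in_itv/= b0 lexx.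
- by rewrite in_itv/= lexx b0.
Qed.

Section lyapunov.
Context (R : realType) (n : nat).
Notation rV := 'rV[R]_n.
Notation e_ i := (delta_mx ord0 i : rV).
Context (U : set (R * rV)) (g : R * rV -> R) (oU : open U) (sg : smooth U g)
  (posU : forall t x, 0 <= t -> U (t, x))
  (pg : forall t, 0 <= t -> torus_periodic (fun x : rV => g (t, x)))
  (K : rV -> rV) (iK : L1_field K) (dK : weak_div_free K)
  (C : R) (C0 : 0 <= C)
  (convC : forall i f x, tsmooth f ->
    conv (fun z => K z ord0 i) f x ^+ 2 <= C * \sum_j tint (fun z => 'D_(e_ j) f z ^+ 2))
  (lambda : R) (glambda : forall t x, 0 <= t -> `|g (t, x)| <= lambda)
  (eqg : forall t x, 0 < t ->
    tslice g t x = laplacian (slice g t) x - transport K (slice g t) x).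

(** The dissipation contains the orders 1 to m+1, one more than [G] is asked to dominate. These are
    exactly the orders in the error term of [energy_step] for the energy of order m+1, so the
    induction closes. *)
Definition lyapunov m (G : R -> R) :=
  [/\ continuous G,
      forall t : R, \sum_(0 <= l < m.+1) energy l (slice g `|t|) <= G t &
      forall t : R, 0 < t -> exists2 g', is_derive t 1 G g' &
        g' <= - \sum_(1 <= l < m.+2) energy l (slice g t)].

Lemma lyapunov_le m G t : lyapunov m G -> 0 <= t -> G t <= G 0.
Proof.
move=> [cG _ dG] t0; apply: nonincreasing_derive => //.
  exact: continuous_subspaceT.
move=> s /andP[s0 _].
have [g' dg' g'le] := dG s s0; exists g' => //.
apply: le_trans g'le _; rewrite oppr_le0; apply: sumr_ge0 => l _.
exact: energy_ge0.
Qed.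

Lemma lyapunov_energy_le m G t l : lyapunov m G -> 0 <= t -> (l <= m)%N ->
  energy l (slice g t) <= G 0.
Proof.
move=> hG t0 lm; apply: le_trans (lyapunov_le hG t0).
case: hG => _ /(_ t) + _; rewrite ger0_norm//; apply: le_trans.
rewrite (bigD1_seq l) ?iota_uniq ?mem_index_iota//= lerDl.
by apply: sumr_ge0 => i _; exact: energy_ge0.
Qed.

Lemma lyapunov_exists m : exists G, lyapunov m G.
Proof.
have ts t : 0 < t -> tsmooth (tslice g t) by exact: (tsmooth_tslice sg posU pg).
have ss t : 0 <= t -> tsmooth (slice g t) by exact: (tsmooth_slice sg posU pg).
have cE := continuous_energy sg posU pg.
have dE := is_derive_energy oU sg posU pg.
elim: m => [|m [G hG]].
  exists (fun t : R => energy 0 (slice g `|t|)); split.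
  - exact: cE.
  - by move=> t; rewrite big_nat1.
  move=> t t0; eexists; first exact: dE.
  rewrite big_nat1 (eq_bigl (pred1 [tuple])); last first.
    by move=> a; rewrite [a]tuple0; exact/esym/eqxx.
  rewrite big_pred1_eq (energy_base iK dK (ss t (ltW t0)) (ts t t0)); last first.
    by move=> x; exact: eqg.
  have := energy_ge0 1 (slice g t); lra.
have [cG G1 dG] := hG.
have G0 : 0 <= G 0.
  by apply: le_trans (G1 0); apply: sumr_ge0 => l _; exact: energy_ge0.
(* c is the error coefficient in [energy_step], with [G 0] as the bound on the lower energies. In
   the weight c + 1 of [G], the part c cancels the error and the part 1 keeps the dissipation of
   orders 1 to m+1; order m+2 comes from the new energy. *)
pose c := #|{: m.+1.-tuple 'I_n}|%:R * (n%:R * (2 ^ m)%:R) ^+ 2 *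
  step_const K lambda C (G 0) : R.
have c0 : 0 <= c.
  by rewrite /c !mulr_ge0// ?sqr_ge0// addr_ge0 ?sqr_ge0 ?mulr_ge0.
exists (fun t : R => energy m.+1 (slice g `|t|) + (c + 1) * G t); split.
- move=> t.
  have cG' : {for t, continuous (fun s : R => (c + 1) * G s)}.
    by apply: continuousM; [exact: cst_continuous|exact: cG].
  exact: (@continuousD _ _ _ (fun s : R => energy m.+1 (slice g `|s|)) _ t (cE m.+1 t) cG').
- move=> t; rewrite big_nat_recr//= addrC lerD2l.
  apply: le_trans (G1 t) _; rewrite mulrDl mul1r lerDr mulr_ge0//.
  by apply: le_trans (G1 t); apply: sumr_ge0 => l _; exact: energy_ge0.
move=> t t0; have [g' dg' g'le] := dG t t0.
eexists; first exact: is_deriveD (dE m.+1 t t0) (is_deriveZ (c + 1) dg').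
rewrite [X in - X]big_nat_recr//= opprD addrC.
have fl x : `|slice g t x| <= lambda by exact: glambda (ltW t0).
have EM l : (1 <= l <= m)%N -> energy l (slice g t) <= G 0.
  by move=> /andP[_ lm]; exact: lyapunov_energy_le hG (ltW t0) lm.
have := energy_step iK C0 convC fl (ss t (ltW t0)) (ts t t0) (fun x => eqg x t0) EM G0.
have -> S : #|{: m.+1.-tuple 'I_n}|%:R * ((n%:R * (2 ^ m)%:R) ^+ 2 *
    (step_const K lambda C (G 0) * S)) = c * S by rewrite /c -!mulrA.
move: (\sum_(1 <= l < m.+2) _) g'le => S g'le step.
have le2 : (c + 1) * g' <= - (c + 1) * S.
  by rewrite mulNr -mulrN ler_wpM2l// addr_ge0.
apply: le_trans (lerD le2 step) _.
by rewrite le_eqVlt; apply/orP; left; apply/eqP; ring.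
Qed.

End lyapunov.

(** * Sobolev inequality *)

Section sobolev.
Context (R : realType).
Notation mu := (@lebesgue_measure R).
Notation unif := (uniform_prob (@half_ltN R)).

Lemma continuous_sqr_sum (h h' : R -> R) : continuous h -> continuous h' ->
  continuous (fun s : R => 2 * (h s ^+ 2 + h' s ^+ 2)).
Proof.
move=> ch ch'.
rewrite (_ : (fun s : R => _) = cst 2 * (h * h + h' * h')); last first.
  by apply/funext => s; rewrite !expr2 !fctE.
move=> s; apply: (@continuousM _ _ (cst 2) (h * h + h' * h') s).
  exact: cst_continuous.
exact: (continuousD (continuousM (ch s) (ch s)) (continuousM (ch' s) (ch' s))).
Qed.

(* Integrate the derivative of [s h(x + s)^2] over [0, 1]. *)
Lemma sobolev_dim1 (h h' : R -> R) (x : R) :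
  continuous h -> continuous h' -> (forall s : R, is_derive s 1 h (h' s)) ->
  (forall s, h (s + 1) = h s) -> (forall s, h' (s + 1) = h' s) ->
  ((h x ^+ 2)%:E <= \int[unif]_s (2 * (h s ^+ 2 + h' s ^+ 2))%:E)%E.
Proof.
move=> ch ch' dh ph ph'.
pose k (s : R) := 2 * (h s ^+ 2 + h' s ^+ 2).
pose F (s : R) := s * (h (s + x) * h (s + x)).
pose f (s : R) := h (s + x) * h (s + x) + s * (2 * h (s + x) * h' (s + x)).
have dhx (s : R) : is_derive s 1 (fun s : R => h (s + x)) (h' (s + x)).
  apply: DeriveDef.
    have [d _] := dh (s + x).
    apply: (@derivable_comp_affine R R R (fun s : R => s + x) id h s 1) d => r.
    by rewrite addrA.
  rewrite (@derive_comp_affine R R R (fun s : R => s + x) id h s 1); last first.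
    by move=> r; rewrite addrA.
  by have [_ ->] := dh (s + x).
have cx (u : R -> R) : continuous u -> continuous (fun s : R => u (s + x)).
  move=> cu s; have c1 : {for s, continuous (fun s : R => s + x)}.
    by apply: continuousD; [exact: cvg_id|exact: cst_continuous].
  exact: (continuous_comp c1 (cu (s + x))).
have dF (s : R) : is_derive s 1 F (f s).
  have := is_deriveM (is_derive_id s 1) (is_deriveM (dhx s) (dhx s)).
  move=> H; apply: is_derive_eq H _; rewrite /f fctE /GRing.scale/=; ring.
have cF : continuous F.
  by move=> s; apply: differentiable_continuous; apply/derivable1_diffP; have [] := dF s.
have cM (u v : R -> R) : continuous u -> continuous v -> continuous (fun s : R => u s * v s).
  by move=> cu cv s; apply: continuousM; [exact: cu|exact: cv].
have cD (u v : R -> R) : continuous u -> continuous v -> continuous (fun s : R => u s + v s).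
  by move=> cu cv s; apply: continuousD; [exact: cu|exact: cv].
have cc (r : R) : continuous (fun _ : R => r) by move=> s; exact: cst_continuous.
have cid : continuous (fun s : R => s) by move=> s; exact: cvg_id.
have cf : continuous f.
  apply: (cD); first by apply: (cM); exact: cx.
  apply: (cM) => //; apply: (cM); last exact: cx.
  by apply: (cM) => //; exact: cx.
have ck : continuous k by exact: continuous_sqr_sum.
have mk : measurable_fun [set: measurableTypeR R] (fun s : measurableTypeR R => (k s)%:E).
  by apply/measurable_EFinP; exact: continuous_measurable_fun.
have k0 s : 0 <= k s by rewrite mulr_ge0// addr_ge0// sqr_ge0.
have : (\int[mu]_(s in `[0%R, 1%R]%classic) (f s)%:E = (F 1)%:E - (F 0)%:E)%E.
  apply: continuous_FTC2 => //; first exact: continuous_subspaceT.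
    split.
    - by move=> s _; have [] := dF s.
    - exact: cvg_at_right_filter (cF 0).
    - exact: cvg_at_left_filter (cF 1).
  by move=> s _; rewrite derive1E; have [] := dF s.
rewrite /F mul0r sube0 mul1r addrC ph -expr2 => <-.
have mkx : measurable_fun [set: measurableTypeR R] (fun s : measurableTypeR R => (k (s + x))%:E).
  by apply/measurable_EFinP; apply: continuous_measurable_fun; exact: cx.
(* Both sides are integrals of the periodic function k over one full period. *)
have <- : (\int[mu]_(s in `[0%R, 1%R]%classic) (k (s + x))%:E = \int[unif]_s (k s)%:E)%E.
  rewrite integral_uniform_half//.
  have pk s : (k (s + 1))%:E = (k s)%:E by rewrite /k ph ph'.
  have k0' s : (0 <= (k s)%:E)%E by rewrite lee_fin.
  rewrite (@ge0_integral_shift R x 0 1 (fun s => (k s)%:E) mk k0') add0r addrC.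
  rewrite (@ge0_integral_shift_periodic R x (fun s => (k s)%:E) mk k0' pk).
  rewrite -(@ge0_integral_shift_periodic R (- 2^-1) (fun s => (k s)%:E) mk k0' pk).
  by have -> : - 2^-1 + 1 = 2^-1 :> R by lra.
apply: le_integral => //.
- by apply: continuous_compact_integrable; [exact: segment_compact|exact: continuous_subspaceT].
- apply: continuous_compact_integrable; first exact: segment_compact.
  by apply: continuous_subspaceT; exact: cx.
move=> s; rewrite inE/= in_itv/= => /andP[s0 s1]; rewrite lee_fin -subr_ge0 /f /k.
(* A decomposition into squares whose coefficients are nonnegative for s in [0, 1]. *)
have -> : 2 * (h (s + x) ^+ 2 + h' (s + x) ^+ 2) -
    (h (s + x) * h (s + x) + s * (2 * h (s + x) * h' (s + x))) =
    (1 - s) * h (s + x) ^+ 2 + (2 - s) * h' (s + x) ^+ 2 +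
    s * (h (s + x) - h' (s + x)) ^+ 2 by ring.
by rewrite !addr_ge0// mulr_ge0 ?sqr_ge0//; lra.
Qed.

Notation e_ i := (delta_mx ord0 i).

Lemma rV_cons_sum n s (y : 'rV[R]_n) :
  rV_cons (s, y) = s *: e_ ord0 + \sum_j y ord0 j *: e_ (lift ord0 j).
Proof.
rewrite delta_rV_cons0 rV_consZ; under eq_bigr do rewrite delta_rV_consS rV_consZ mulr0.
have -> : \sum_j rV_cons (0 : R, y ord0 j *: e_ j) =
    rV_cons (0 : R, \sum_j y ord0 j *: e_ j : 'rV[R]_n).
  apply: (big_ind2 (fun u v => u = rV_cons (0 : R, v))) => //.
    have := rV_consZ 0 (0 : R) (0 : 'rV[R]_n).
    by rewrite scale0r mul0r scaler0.
  by move=> u1 v1 u2 v2 -> ->; rewrite rV_consD addr0.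
by rewrite -row_sum_delta rV_consD mulr1 scaler0 addr0 add0r.
Qed.

Let rV_cons_affine n (s h : R) (w y : 'rV[R]_n) :
  rV_cons (s, h *: w + y) = h *: rV_cons (0, w) + rV_cons (s, y).
Proof. by rewrite rV_consZ rV_consD mulr0 add0r. Qed.

Lemma differentiable_rV_cons n s (y : 'rV[R]_n) :
  differentiable (fun y : 'rV[R]_n => rV_cons (s, y)) y.
Proof.
rewrite (_ : (fun y : 'rV[R]_n => rV_cons (s, y)) = (cst (s *: e_ ord0)) +
    \sum_j (fun y : 'rV[R]_n => y ord0 j *: (e_ (lift ord0 j) : 'rV[R]_n.+1))).
  apply: differentiableD; first exact: differentiable_cst.
  apply: differentiable_sum => j; apply: differentiableZl.
  exact: differentiable_coord.
by apply/funext => z; rewrite rV_cons_sum fctE fct_sumE.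
Qed.

Lemma dd_rV_cons n (f : 'rV[R]_n.+1 -> R) a s (y : 'rV[R]_n) :
  dd a (fun y : 'rV[R]_n => f (rV_cons (s, y))) y =
  dd [seq lift ord0 j | j <- a] f (rV_cons (s, y)).
Proof.
rewrite /dd (@Ds_comp_affine R 'rV[R]_n.+1 'rV[R]_n (fun y => rV_cons (s, y))
  (fun w => rV_cons (0, w)) f _ (@rV_cons_affine n s)) -!map_comp.
by congr (Ds _ f _); apply: eq_map => j /=; rewrite delta_rV_consS.
Qed.

Lemma tsmooth_rV_cons n (f : 'rV[R]_n.+1 -> R) s : tsmooth f ->
  tsmooth (fun y : 'rV[R]_n => f (rV_cons (s, y))).
Proof.
move=> [pf sf]; split => [i y|].
  rewrite -[RHS](pf (lift ord0 i)) delta_rV_consS rV_consD addr0//.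
exact: (@smooth_comp_affine R 'rV[R]_n.+1 'rV[R]_n (fun y => rV_cons (s, y))
  (fun w => rV_cons (0, w)) f setT (@rV_cons_affine n s) (@differentiable_rV_cons n s) sf).
Qed.

(** One increasing list for each set of coordinates, built along the recursion of [rV_cons]: the
    first coordinate is either left out or differentiated once. *)
Fixpoint subseqs_ord n : seq (seq 'I_n) :=
  if n is m.+1 then
    [seq [seq lift ord0 j | j <- b] | b <- subseqs_ord m] ++
    [seq ord0 :: [seq lift ord0 j | j <- b] | b <- subseqs_ord m]
  else [:: [::]].

Lemma size_subseqs_ord n : size (subseqs_ord n) = (2 ^ n)%N.
Proof. by elim: n => //= n IH; rewrite size_cat !size_map IH expnS mul2n addnn. Qed.

Lemma subseqs_ord_size n b : b \in subseqs_ord n -> (size b <= n)%N.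
Proof.
elim: n b => [|n IH] b /=; first by rewrite inE => /eqP ->.
by rewrite mem_cat => /orP[] /mapP[c /IH cn ->]; rewrite /= size_map// ltnW.
Qed.

Definition mixed_sum n (f : 'rV[R]_n -> R) x := \sum_(b <- subseqs_ord n) dd b f x ^+ 2.

Lemma tcont_mixed_sum n (f : 'rV[R]_n -> R) : tsmooth f -> tcont (mixed_sum f).
Proof. by move=> sf; apply: tcont_sum => b _; apply: tcontX; exact: tcont_dd. Qed.

Lemma mixed_sum_ge0 n (f : 'rV[R]_n -> R) x : 0 <= mixed_sum f x.
Proof. by apply: sumr_ge0 => b _; exact: sqr_ge0. Qed.

Lemma mixed_sumS n (f : 'rV[R]_n.+1 -> R) s (y : 'rV[R]_n) : tsmooth f ->
  mixed_sum f (rV_cons (s, y)) =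
  mixed_sum (fun y : 'rV[R]_n => f (rV_cons (s, y))) y +
  mixed_sum (fun y : 'rV[R]_n => 'D_(e_ ord0) f (rV_cons (s, y))) y.
Proof.
move=> sf; rewrite /mixed_sum /= big_cat !big_map/=; congr (_ + _); apply: eq_bigr => b _.
  by rewrite dd_rV_cons.
congr (_ ^+ 2); apply: etrans (esym (dd_rV_cons ('D_(e_ ord0) f) b s y)).
by rewrite dd_D.
Qed.

Lemma EFin_tint n (f : 'rV[R]_n -> R) : tcont f ->
  ((tint f)%:E = \int[torus R n]_x (f x)%:E)%E.
Proof.
move=> cf; rewrite /tint /Rintegral fineK//.
exact: (integrable_fin_num measurableT (tcont_integrable cf)).
Qed.

(** The one-dimensional inequality in the first coordinate bounds f^2 by an integral over s of f^2
    and the square of its first partial derivative; induction applies to both on each slice. Every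
    coordinate costs a factor 2. *)
Lemma sobolev n (f : 'rV[R]_n -> R) x : tsmooth f ->
  f x ^+ 2 <= (2 ^ n)%:R * tint (mixed_sum f).
Proof.
elim: n => [|n IH] in f x *.
  move=> sf; rewrite mul1r (_ : mixed_sum f = fun=> f x ^+ 2) ?tint_cst//.
  by apply/funext => y; rewrite /mixed_sum big_seq1 /dd/= [x]thinmx0 [y]thinmx0.
move=> sf; rewrite -lee_fin [leRHS]EFinM (EFin_tint (tcont_mixed_sum sf)).
have Q0 y : (0 <= (mixed_sum f y)%:E)%E by rewrite lee_fin mixed_sum_ge0.
have mQ : measurable_fun setT (fun y : 'rV[R]_n.+1 => (mixed_sum f y)%:E).
  by apply/measurable_EFinP; exact: tcont_measurable (tcont_mixed_sum sf).
have sDf := tsmooth_D (e_ ord0) sf.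
rewrite ge0_integral_torusS//.
set x0 := x ord0 ord0; set x' := rV_behead x.
pose h s := f (rV_cons (s, x')); pose h' s := 'D_(e_ ord0) f (rV_cons (s, x')).
have lineE s : rV_cons (0, x') + s *: e_ ord0 = rV_cons (s, x').
  by rewrite delta_rV_cons0 rV_consZ rV_consD mulr1 scaler0 add0r addr0.
have dline (u : 'rV[R]_n.+1 -> R) (s : R) : tsmooth u ->
    is_derive s 1 (fun s => u (rV_cons (s, x'))) ('D_(e_ ord0) u (rV_cons (s, x'))).
  move=> su; have := @is_derive_line R _ u (rV_cons (0, x')) (e_ ord0) s (tsmooth_derivable su).
  by rewrite lineE; under [X in is_derive _ _ X _]eq_fun do rewrite lineE.
have cline (u : 'rV[R]_n.+1 -> R) : tsmooth u -> continuous (fun s : R => u (rV_cons (s, x'))).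
  move=> su s; apply: differentiable_continuous; apply/derivable1_diffP.
  by have [] := dline u s su.
have pline (u : 'rV[R]_n.+1 -> R) s : tsmooth u -> u (rV_cons (s + 1, x')) = u (rV_cons (s, x')).
  by move=> [pu _]; rewrite -[RHS](pu ord0) delta_rV_cons0 rV_consD addr0.
have := @sobolev_dim1 h h' x0 (cline _ sf) (cline _ sDf) (fun s => dline f s sf)
  (fun s => pline f s sf) (fun s => pline _ s sDf).
rewrite /h rV_consK => /le_trans; apply.
have mI : measurable_fun [set: measurableTypeR R]
    (fun s : measurableTypeR R => \int[torus R n]_y (mixed_sum f (rV_cons (s, y)))%:E)%E.
  apply: (@measurable_fun_fubini_tonelli_F _ _ _ _ R (torus R n)
    (fun p : measurableTypeR R * 'rV[R]_n => (mixed_sum f (rV_cons p))%:E)) => //.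
  exact: (measurableT_comp mQ (@measurable_rV_cons R n)).
have I0 s : (0 <= \int[torus R n]_y (mixed_sum f (rV_cons (s, y)))%:E)%E.
  by apply: integral_ge0 => y _; rewrite lee_fin mixed_sum_ge0.
rewrite -ge0_integralZl//.
have c1 := cline _ sf; have c2 := cline _ sDf.
apply: ge0_le_integral => //.
- by move=> s _; rewrite lee_fin mulr_ge0// addr_ge0// sqr_ge0.
- by apply/measurable_EFinP; exact: continuous_measurable_fun (continuous_sqr_sum c1 c2).
- exact: measurable_funeM.
move=> s _.
have sfs := tsmooth_rV_cons s sf; have sDfs := tsmooth_rV_cons s sDf.
rewrite (_ : (fun y => _) = fun y : 'rV[R]_n =>
  (mixed_sum (fun y : 'rV[R]_n => f (rV_cons (s, y))) y +
   mixed_sum (fun y : 'rV[R]_n => 'D_(e_ ord0) f (rV_cons (s, y))) y)%:E); last first.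
  by apply/funext => y; rewrite mixed_sumS.
rewrite -EFin_tint; last by apply: tcontD; exact: tcont_mixed_sum.
rewrite -EFinM lee_fin tintD; [|exact: tcont_mixed_sum..].
rewrite expnS natrM -mulrA ler_wpM2l// mulrDr lerD//.
  exact: (IH _ x' sfs).
exact: (IH _ x' sDfs).
Qed.

Lemma tint_dd_le_energy n (u : 'rV[R]_n -> R) a :
  tint (fun x => dd a u x ^+ 2) <= energy (size a) u.
Proof.
rewrite /energy (bigD1 (in_tuple a))//= lerDl; apply: sumr_ge0 => b _.
by apply: tint_ge0 => x; exact: sqr_ge0.
Qed.

(** One factor 2^n is the Sobolev constant, the other the number of sets of coordinates. As [a] is
    nonempty, the energy of order 0, which is not dissipated, stays out of the sum. *)
Lemma sobolev_energy n (u : 'rV[R]_n -> R) a x : tsmooth u -> (1 <= size a)%N ->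
  dd a u x ^+ 2 <= (2 ^ n)%:R * ((2 ^ n)%:R *
    \sum_(1 <= l < (n + size a).+1) energy l u).
Proof.
move=> su a1; apply: le_trans (sobolev x (tsmooth_dd a su)) _.
rewrite ler_wpM2l// /mixed_sum tint_sum; last first.
  by move=> b _; apply/tcontX/tcont_dd/tsmooth_dd.
rewrite -size_subseqs_ord; apply: ler_sum_size => b /subseqs_ord_size bn.
have -> : dd b (dd a u) = dd (b ++ a) u by rewrite /dd map_cat Ds_cat.
apply: le_trans (tint_dd_le_energy u (b ++ a)) _.
have ba : (1 <= size (b ++ a) < (n + size a).+1)%N.
  by rewrite size_cat ltnS leq_add2r bn andbT (leq_trans a1)// leq_addl.
rewrite (bigD1_seq (size (b ++ a))) ?iota_uniq ?mem_index_iota//= lerDl.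
by apply: sumr_ge0 => i _; exact: energy_ge0.
Qed.

End sobolev.

(** * Uniform bounds *)

(* Unlike [ge0_le_integral], no measurability is required. *)
Lemma ge0_le_integral_nomeas d (T : measurableType d) (R : realType)
    (mu : {measure set T -> \bar R}) (D : set T) (f g : T -> \bar R) :
  (forall x, D x -> 0 <= f x)%E -> (forall x, D x -> f x <= g x)%E ->
  (\int[mu]_(x in D) f x <= \int[mu]_(x in D) g x)%E.
Proof.
move=> f0 fg; have g0 x : D x -> (0 <= g x)%E.
  by move=> Dx; exact: le_trans (f0 x Dx) (fg x Dx).
rewrite !ge0_integralE//; apply: ge_ereal_sup => _ [h hf <-].
apply: ereal_sup_ubound; exists h => //= x.
by apply: le_trans (hf x) _; exact: lee_restrict.
Qed.

Lemma Loo_norm_le (R : realType) n (f : 'rV[R]_n -> R) (c : R) :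
  (forall x, `|f x| <= c) -> (Loo_norm f <= c%:E)%E.
Proof.
move=> fc; rewrite /Loo_norm unlock ifT; last first.
  by rewrite [ltRHS](probability_setT (torus R n)) lte_fin.
by apply/ess_supP; apply: aeW => x; rewrite lee_fin.
Qed.

Lemma Loo_norm_sqr_le (R : realType) n (f : 'rV[R]_n -> R) (c : R) : 0 <= c ->
  (forall x, f x ^+ 2 <= c) ->
  (Loo_norm f <= (Num.sqrt c)%:E)%E /\ (Loo_norm f ^+ 2 <= c%:E)%E.
Proof.
move=> c0 fc.
have le : (Loo_norm f <= (Num.sqrt c)%:E)%E.
  apply: Loo_norm_le => x.
  by rewrite -sqrtr_sqr ler_sqrt.
split=> //; rewrite expe2 -(sqr_sqrtr c0) expr2 EFinM.
by apply: lee_pmul => //; exact: Lnorm_ge0.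
Qed.

(** [G] plus the primitive of [S] is nonincreasing, and [G t] is nonnegative. *)
Lemma integral_lyapunov_le (R : realType) (G S : R -> R) (t : R) : 0 <= t ->
  continuous G -> continuous S -> (forall s, 0 <= S s) -> 0 <= G t ->
  (forall s : R, 0 < s -> exists2 g', is_derive s 1 G g' & g' <= - S s) ->
  (\int[lebesgue_measure]_(s in `[0%R, t]) (S s)%:E <= (G 0)%:E)%E.
Proof.
move=> t0 cG cS S0 Gt dG.
have iS a b : lebesgue_measure.-integrable `[a, b]%classic (EFin \o S).
  by apply: continuous_compact_integrable; [exact: segment_compact|exact: continuous_subspaceT].
(* Starting the primitive at -1 makes 0 an interior point, where the fundamental theorem also gives
   continuity. *)
pose P x := \int[lebesgue_measure]_(s in [set` `[(-1 : R), x]]) S s.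
have dP (x : R) : -1 < x -> is_derive x 1 P (S x).
  move=> x1; have xu : x < x + 1 by rewrite ltrDl.
  have [d e] := continuous_FTC1_closed xu (iS (-1) (x + 1)) x1 (cS x).
  by apply: DeriveDef => //; rewrite -derive1E.
have : G t + P t <= G 0 + P 0.
  apply: (@nonincreasing_derive R (fun s => G s + P s)) => //.
    apply: continuous_in_subspaceT => s /set_mem/=; rewrite in_itv/= => /andP[s0 _].
    apply: continuousD; first exact: cG.
    apply: differentiable_continuous; apply/derivable1_diffP.
    by have [] := dP s (lt_le_trans (@ltrN10 R) s0).
  move=> s /andP[s0 _]; have [g' dg' g'S] := dG s s0.
  exists (g' + S s); last by rewrite -lerBrDr sub0r.
  exact: is_deriveD dg' (dP s (lt_trans (@ltrN10 R) s0)).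
have -> : (\int[lebesgue_measure]_(s in `[0%R, t]) (S s)%:E = (P t - P 0)%:E)%E.
  rewrite /P Rintegral_itvB ?bnd_simp//.
  rewrite Rintegral_itv_obnd_cbnd; last first.
    by apply: integrableS (iS 0 t) => //; exact: subset_itv_oc_cc.
  by rewrite /Rintegral fineK//; exact: (integrable_fin_num _ (iS 0 t)).
by rewrite lee_fin; lra.
Qed.

(** By the product rule the two forms of the nonlinearity differ by f times the divergence of K * f,
    which is zero. *)
Lemma divergence_transport (R : realType) n (K : 'rV[R]_n -> 'rV[R]_n) f x :
  torus_periodic K -> L1_field K -> weak_div_free K -> tsmooth f ->
  divergence (fun y => f y *: torus_conv K f y) x = transport K f x.
Proof.
move=> pK iK dK sf; rewrite /divergence /transport.
have E i : partial i (fun y => (f y *: torus_conv K f y) ord0 i) x =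
    conv (fun z => K z ord0 i) f x * 'D_(delta_mx ord0 i) f x +
    f x * conv (fun z => K z ord0 i) ('D_(delta_mx ord0 i) f) x.
  rewrite /partial (_ : (fun y => _) = f * conv (fun z => K z ord0 i) f); last first.
    by apply/funext => y; rewrite mxE torus_convE//; exact: tsmooth_tcont.
  have [d1 e1] := conv_derive x (delta_mx ord0 i) (iK i) sf.
  have df : derivable f x (delta_mx ord0 i) by exact: (tsmooth_derivable sf).
  by rewrite (deriveM df d1) e1 addrC.
under eq_bigr do rewrite E.
by rewrite big_split/= -mulr_sumr (conv_div_free x iK dK sf) mulr0 addr0.
Qed.

Unset Implicit Arguments.
Set Strict Implicit.
Set Printing Implicit Defensive.

Theorem lemma1 (R : realType) (d : nat) (d_ge2 : (2 <= d)%N)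
    (K : 'rV[R]_d -> 'rV[R]_d) (perK : torus_periodic K)
    (L1K : L1_field K) (divK : weak_div_free K)
    (V : 'rV[R]_d -> 'M[R]_d) (perV : torus_periodic V)
    (LooV : Loo_field V) (KdivV : weak_div_eq K V)
    (lambda : R) (lambda_gt1 : 1 < lambda)
    (rho0 : 'rV[R]_d -> R) (per0 : torus_periodic rho0)
    (dens0 : probability_density rho0)
    (smooth0 : smooth_between lambda setT rho0)
    (bnd0 : forall n : nat, (1 <= n)%N -> forall a : n.-tuple 'I_d,
       (Loo_norm (partials a rho0) < +oo)%E)
    (rho : R -> 'rV[R]_d -> R) (solrho : is_solution lambda K rho0 rho)
    (n : nat) (n_ge1 : (1 <= n)%N) (a : n.-tuple 'I_d) :
  exists Cu Coo : R, [/\ 0 < Cu, 0 < Coo &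
    forall t : R, 0 <= t ->
      (Loo_norm (partials a (rho t)) <= Cu%:E)%E /\
      (\int[lebesgue_measure]_(s in `[0%R, t])
         (Loo_norm (partials a (rho s)) ^+ 2) <= Coo%:E)%E].
Proof.
have [per [[U [g [oU AU gE sg]]] bnd] eq _] := solrho.
have {}sg : smooth U g by exact: sg.
have posU t (x : 'rV[R]_d) : 0 <= t -> U (t, x) by move=> t0; exact: AU.
have gslice t : 0 <= t -> slice g t = rho t.
  by move=> t0; apply/funext => x; exact: (gE (t, x)).
have pg t : 0 <= t -> torus_periodic (fun x : 'rV[R]_d => g (t, x)).
  by move=> t0; rewrite -[X in torus_periodic X]/(slice g t) gslice//; exact: per.
have lambda0 : 0 < lambda by exact: lt_trans ltr01 lambda_gt1.
have glambda t (x : 'rV[R]_d) : 0 <= t -> `|g (t, x)| <= lambda.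
  move=> t0; rewrite (gE (t, x))//.
  have /andP[lo hi] := bnd (t, x) t0.
  by rewrite ger0_norm//; apply: le_trans lo; rewrite invr_ge0 ltW.
have [C C0 convC] := conv_Loo_bound L1K KdivV LooV.
have ss t : 0 <= t -> tsmooth (slice g t) by exact: tsmooth_slice sg posU pg _.
have eqg t (x : 'rV[R]_d) : 0 < t ->
    tslice g t x = laplacian (slice g t) x - transport K (slice g t) x.
  move=> t0; have [_ e1] := is_derive_time posU x sg (ltW t0).
  rewrite /tslice -[LHS]e1.
  have -> : 'D_1 (fun s : R => g (s, x)) t = derive1 (rho^~ x) t.
    rewrite derive1E; apply: near_eq_derive.
    have t00 : `]0, +oo[%classic t by rewrite /= in_itv/= t0.
    have := open_nbhs_nbhs (conj (@interval_open R (BRight 0) +oo%O isT isT) t00).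
    apply: filterS => s; rewrite /= in_itv/= andbT => s0.
    by rewrite (gE (s, x))//=; exact: ltW.
  rewrite eq// -gslice ?ltW// addrC; congr (_ - _).
  have sf := ss t (ltW t0).
  exact: divergence_transport.
(* The Sobolev inequality adds up to d derivatives to the n of the statement. *)
have [G hG] := lyapunov_exists oU sg posU pg L1K divK C0 convC glambda eqg (d + n).
have [cG Gge dG] := hG.
pose c : R := (2 ^ d)%:R * (2 ^ d)%:R.
have c0 : 0 <= c by rewrite mulr_ge0.
(* A single function bounds the squared sup norm, is at most [c * G], and is at most c times the
   dissipation of [G]; the first two facts give the uniform bound, the first and third the time
   integral. *)
pose S (s : R) := c * \sum_(1 <= l < (d + n).+1) energy l (slice g `|s|).
have S0 s : 0 <= S s.
  by rewrite mulr_ge0//; apply: sumr_ge0 => l _; exact: energy_ge0.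
have SG s : S s <= c * G s.
  rewrite ler_wpM2l//; apply: le_trans (Gge s).
  by rewrite [leRHS]big_ltn// lerDr energy_ge0.
have aS s x : 0 <= s -> partials a (rho s) x ^+ 2 <= S s.
  move=> s0; rewrite partialsE -gslice// /S ger0_norm// -mulrA.
  have := sobolev_energy x (ss s s0) (a := a); rewrite size_tuple; exact.
have S_G0 s : 0 <= s -> S s <= c * G 0.
  by move=> s0; apply: le_trans (SG s) _; rewrite ler_wpM2l//; exact: (lyapunov_le hG s0).
have cG0 : 0 <= c * G 0 by exact: le_trans (S0 0) (SG 0).
(* The summand 1 makes the constants strictly positive. *)
exists (Num.sqrt (c * G 0) + 1), (c * G 0 + 1); split.
- by rewrite ltr_wpDl// sqrtr_ge0.
- by rewrite ltr_wpDl.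
move=> t t0; split.
  have [le _] := Loo_norm_sqr_le cG0 (fun x => le_trans (aS t x t0) (S_G0 t t0)).
  by apply: le_trans le _; rewrite lee_fin lerDl.
(* Passing to the continuous majorant [S] avoids the question whether the sup norm is measurable in
   time. *)
apply: (@le_trans _ _ (\int[lebesgue_measure]_(s in `[0%R, t]) (S s)%:E)%E).
  apply: ge0_le_integral_nomeas => s st; have s0 : 0 <= s by case/andP: st.
    by rewrite expe2 mule_ge0//; exact: Lnorm_ge0.
  by have [_] := Loo_norm_sqr_le (S0 s) (fun x => aS s x s0).
apply: (@le_trans _ _ (c * G 0)%:E); last by rewrite lee_fin lerDl.
have cE l : continuous (fun s : R => energy l (slice g `|s|)).
  exact: continuous_energy sg posU pg l.
have cE_sum : continuous (fun s : R =>
    \sum_(1 <= l < (d + n).+1) energy l (slice g `|s|)).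
  exact: continuous_sum_seq cE.
have cS : continuous S.
  by move=> s; exact: (continuousM (@cst_continuous _ _ c s) (cE_sum s)).
apply: (@integral_lyapunov_le R (fun s => c * G s) S t t0 _ cS S0).
- move=> s; apply: (@continuousM _ _ (cst c) G s (@cst_continuous _ _ c s) (cG s)).
- exact: le_trans (S0 t) (SG t).
move=> s s0; have [g' dg' g'le] := dG s s0.
exists (c * g'); first exact: is_deriveZ.
rewrite -mulrN ler_wpM2l//; apply: le_trans g'le _.
by rewrite gtr0_norm// lerN2 [leRHS]big_nat_recr//= lerDl energy_ge0.
Qed.
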